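(* Let $N\ge 1$, let $t_1,\dots,t_N\in[0,1]$ and let $\mu_{t_1},\dots,\mu_{t_N}\in\mathcal{P}_2(\mathbf{R}^d)$. For $\pi\in\mathcal{P}_2(\mathbf{R}^{2d})$ set $$F(\pi):=\sum_{i=1}^{N}\frac1N\, W_2^2\big(((1-t_i)\mathbf{x}_0+t_i\mathbf{x}_1)_\#\pi,\ \mu_{t_i}\big).$$ Then $$\inf_{\pi\in\mathcal{P}_2(\mathbf{R}^{2d})}F(\pi)=\inf_{\gamma}\int_{\mathbf{R}^{(N+2)d}}\sum_{i=1}^{N}\frac1N\,\big\|(1-t_i)\mathbf{x}_0+t_i\mathbf{x}_1-\mathbf{y}_i\big\|^2\,d\gamma(\mathbf{x}_0,\mathbf{x}_1,\mathbf{y}_1,\dots,\mathbf{y}_N),$$ where the infimum on the right is over all $\gamma\in\mathcal{P}_2(\mathbf{R}^{(N+2)d})$ satisfying $(\mathbf{y}_i)_\#\gamma=\mu_{t_i}$ for all $i=1,\dots,N$. Moreover, a minimizer of $F$ over $\mathcal{P}_2(\mathbf{R}^{2d})$ exists and is given by $\pi^*=(\mathbf{x}_0,\mathbf{x}_1)_\#\gamma^*$, where $\gamma^*$ is a minimizer of the right-hand side (that is, the right-hand infimum is attained, and for any minimizer $\gamma^*$ of it, $\pi^*$ minimizes $F$).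
   Context: $\mathcal{P}_2(\mathbf{R}^n)$ is the set of Borel probability measures on $\mathbf{R}^n$ with finite second moment. $T_\#\mu$ denotes the push-forward of $\mu$ by a measurable map $T$: $T_\#\mu(B)=\mu(T^{-1}(B))$. $W_2$ is the Wasserstein distance: $W_2^2(\mu,\nu)=\inf_{\eta\in\Pi(\mu,\nu)}\int\|\mathbf{x}-\mathbf{y}\|^2\,d\eta(\mathbf{x},\mathbf{y})$, with $\Pi(\mu,\nu)$ the set of couplings of $\mu$ and $\nu$ and $\|\cdot\|$ the Euclidean norm. Points of $\mathbf{R}^{2d}=\mathbf{R}^d\times\mathbf{R}^d$ are written $(\mathbf{x}_0,\mathbf{x}_1)$, and points of $\mathbf{R}^{(N+2)d}=(\mathbf{R}^d)^{N+2}$ are written $(\mathbf{x}_0,\mathbf{x}_1,\mathbf{y}_1,\dots,\mathbf{y}_N)$. The symbols $\mathbf{x}_0,\mathbf{x}_1,\mathbf{y}_i$ also denote the corresponding coordinate projections: $(\mathbf{y}_i)_\#\gamma$ is the $\mathbf{y}_i$-marginal of $\gamma$, $(\mathbf{x}_0,\mathbf{x}_1)_\#\gamma$ is the joint marginal of $\gamma$ in $(\mathbf{x}_0,\mathbf{x}_1)$, and $((1-t)\mathbf{x}_0+t\mathbf{x}_1)_\#\pi$ is the push-forward of $\pi$ under $(\mathbf{x}_0,\mathbf{x}_1)\mapsto(1-t)\mathbf{x}_0+t\mathbf{x}_1$. *)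

(* Defs.v *)
From HB Require Import structures.
From mathcomp Require Export all_boot all_order all_algebra.
From mathcomp Require Export all_classical all_reals all_analysis.

Set Implicit Arguments.
Unset Strict Implicit.
Unset Printing Implicit Defensive.

Import Order.TTheory GRing.Theory Num.Theory numFieldNormedType.Exports.

Local Open Scope classical_set_scope.
Local Open Scope ring_scope.

(* The space (R^d)^k = R^(k d) with its Borel sigma-algebra. A point is a
   k x d matrix whose rows are its k components in R^d; a single point of R^d
   is a row vector. The topology on matrices is the product topology, hence
   the Euclidean one. *)
Definition Rpow (R : realType) (k d : nat) :=
  g_sigma_algebraType (@open 'M[R]_(k, d)).

Lemma continuous_mx (R : realType) (m n p q : nat)
    (f : 'M[R]_(m, n) -> 'M[R]_(p, q)) :
  (forall i j, continuous (fun x => f x i j)) -> continuous f.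
Proof.
move=> cf x A [P nP sPA].
have: \forall y \near x, forall i j, P i j (f y i j).
  apply: (@filter_forall _ _ (fun i y => forall j, P i j (f y i j)) (nbhs x) (nbhs_filter x)) => i.
  apply: (@filter_forall _ _ (fun j y => P i j (f y i j)) (nbhs x) (nbhs_filter x)) => j.
  exact: (cf i j x (P i j) (nP i j)).
by apply: filterS => y Py; exact: sPA.
Qed.

Lemma continuous_Rpow (R : realType) (m n p q : nat)
    (f : 'M[R]_(m, n) -> 'M[R]_(p, q)) :
  continuous f ->
  measurable_fun (T := Rpow R m n) (U := Rpow R p q) [set: Rpow R m n] f.
Proof.
move=> /continuousP cf; apply: (@measurability _ _ (Rpow R m n) (Rpow R p q) setT f open) => //.
move=> _ [B oB <-]; rewrite setTI; apply: sub_sigma_algebra; exact: cf.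
Qed.

Section Euclidean.
Context {R : realType}.

(* The library's norm `|x| on matrices is the sup norm. *)
Definition enorm (m n : nat) (x : 'M[R]_(m, n)) : R :=
  Num.sqrt (\sum_(i < m) \sum_(j < n) x i j ^+ 2).

Definition component (k d : nat) (i : 'I_k) : Rpow R k d -> Rpow R 1 d :=
  fun x => row i x.

(* In (R^d)^(2 + N), rows 0 and 1 are x_0 and x_1, row (rshift 2 i) is y_i. *)
Definition first2 (N d : nat) : Rpow R (2 + N) d -> Rpow R 2 d :=
  fun z => usubmx z.

Definition interp (d : nat) (t : R) : Rpow R 2 d -> Rpow R 1 d :=
  fun x => (1 - t) *: row 0 x + t *: row 1 x.

Lemma measurable_component k d (i : 'I_k) :
  measurable_fun [set: Rpow R k d] (component i).
Proof.
apply: continuous_Rpow; apply: continuous_mx => a b.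
under eq_fun do rewrite mxE.
exact: coord_continuous.
Qed.

Lemma measurable_first2 N d :
  measurable_fun [set: Rpow R (2 + N) d] (@first2 N d).
Proof.
apply: continuous_Rpow; apply: continuous_mx => a b.
under eq_fun do rewrite mxE.
exact: coord_continuous.
Qed.

Lemma measurable_interp d (t : R) :
  measurable_fun [set: Rpow R 2 d] (@interp d t).
Proof.
apply: continuous_Rpow; apply: continuous_mx => a b.
under eq_fun do rewrite !mxE.
have c k s : continuous (fun x : 'M[R]_(2, d) => s * x k b).
  by move=> x; apply: continuousM; [exact: cst_continuous|exact: coord_continuous].
by move=> x; apply: (@continuousD _ _ _ _ _ x); exact: c.
Qed.

HB.instance Definition _ k d (i : 'I_k) :=
  isMeasurableFun.Build _ _ _ _ (@component k d i) (@measurable_component k d i).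
HB.instance Definition _ N d :=
  isMeasurableFun.Build _ _ _ _ (@first2 N d) (@measurable_first2 N d).
HB.instance Definition _ d t :=
  isMeasurableFun.Build _ _ _ _ (@interp d t) (@measurable_interp d t).

Local Open Scope ereal_scope.

Definition P2 (k d : nat) : set (probability (Rpow R k d) R) :=
  [set mu : probability (Rpow R k d) R | \int[mu]_x (enorm x ^+ 2)%:E < +oo].

(* Two probabilities are identified when they agree on Borel sets: a library
   measure is a function on all sets, unspecified on the non-measurable ones,
   so Leibniz equality would be too strong. *)
Definition same_law (k d : nat) (mu nu : probability (Rpow R k d) R) : Prop :=
  forall B : set (Rpow R k d), measurable B -> mu B = nu B.

Definition couplings (d : nat) (mu nu : probability (Rpow R 1 d) R) :
    set (probability (Rpow R 2 d) R) :=
  [set eta : probability (Rpow R 2 d) R |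
             same_law (distribution eta (@component 2 d 0%R)) mu /\
             same_law (distribution eta (@component 2 d 1%R)) nu].

Definition transport_cost (d : nat) (eta : probability (Rpow R 2 d) R) : \bar R :=
  \int[eta]_z (enorm (@component 2 d 0 z - @component 2 d 1 z)%R ^+ 2)%:E.

(* The square of the Wasserstein distance. *)
Definition W2sq (d : nat) (mu nu : probability (Rpow R 1 d) R) : \bar R :=
  ereal_inf [set transport_cost eta | eta in couplings mu nu].

Definition is_minimizer (T : Type) (S : set T) (F : T -> \bar R) (x : T) : Prop :=
  S x /\ forall y, S y -> F x <= F y.

Section Problems.
Variables (d N : nat) (t : 'I_N -> R).
Variable mu : 'I_N -> probability (Rpow R 1 d) R.

Definition F_obj (pi : probability (Rpow R 2 d) R) : \bar R :=
  \sum_(i < N) (N%:R^-1)%:E * W2sq (distribution pi (interp (t i))) (mu i).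

Definition feasible : set (probability (Rpow R (2 + N) d) R) :=
  [set gamma : probability (Rpow R (2 + N) d) R | P2 gamma /\
     forall i : 'I_N, same_law (distribution gamma (component (rshift 2 i))) (mu i)].

Definition G_obj (gamma : probability (Rpow R (2 + N) d) R) : \bar R :=
  \int[gamma]_z (\sum_(i < N) N%:R^-1 *
     enorm (interp (t i) (first2 z) - component (rshift 2 i) z) ^+ 2)%R%:E.

End Problems.

End Euclidean.

(* Main.v *)
From HB Require Import structures.
From mathcomp Require Import measurable_realfun ring lra.
Require Import Defs.
Set Implicit Arguments.
Unset Strict Implicit.
Unset Printing Implicit Defensive.
Import Order.TTheory GRing.Theory Num.Theory numFieldNormedType.Exports.

Local Open Scope classical_set_scope.
Local Open Scope ring_scope.
Local Open Scope ereal_scope.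

(** The two infima agree because each problem bounds the other.

    If gamma is feasible on the right, the joint law of the interpolated point
    and of y_i under gamma is a coupling of the i-th interpolated marginal of
    pi = (x_0, x_1)_# gamma with mu_i, so F pi is at most the cost of gamma
    ([F_obj_le_G_obj]).

    Conversely, given pi and nearly optimal couplings eta_i of its interpolated
    marginals with the mu_i, one glues them along pi. An exact gluing would
    disintegrate the eta_i, but an infimum only needs an approximate one
    ([glue_family]): cut R^d into countably many small cells, and, given that
    the interpolated point lies in a cell, draw (z_i, y_i) from eta_i
    conditioned on z_i lying in the same cell. The marginals are exact, and z_i
    is so close to the interpolated point that the cost grows by at most epsilon
    ([glued_cost], [G_obj_le_F_obj]). These two bounds also show that the image
    of any minimizer of the right-hand side minimizes F.

    It remains to find a minimizer on the right ([G_obj_has_minimizer]). The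
    laws of (x_0, x_1) along a minimizing sequence need not be tight (for
    instance x_1 is free if all times vanish), but for given y_1, ..., y_N the
    best (x_0, x_1) is an ordinary least squares fit, which is linear in y
    ([ols_optimal]). Replacing (x_0, x_1) by this fit leaves the minimization of
    the integral of a continuous nonnegative function of y, the [residual], over
    the couplings of mu_1, ..., mu_N.

    Such couplings are sequentially compact ([multicoupling_limit]). A vector y
    is encoded by the countably many bits telling which of its coordinates
    exceed which rationals. The probabilities of all finite bit patterns
    converge along an ultrafilter, and the limits are the probabilities of bit
    patterns of random bits on [0, 1) with Lebesgue measure ([bits_of_weights]).
    Events on a single y_i have the same probability along the whole sequence.
    Hence, almost surely, the limit bits for each coordinate form an open lower
    cut of the rationals that is neither empty nor full, and decode to a real
    number; the decoded law has the right marginals. A continuous nonnegative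
    cost is the limit from below of functions of finitely many bits, so its
    integral can only drop in the limit, by Fatou's lemma. *)

(** * Borel sets of matrix spaces *)

Section BorelRpow.
Context {R : realType} {m n : nat}.

Definition halfspace (j : 'I_m * 'I_n * rat) : set (Rpow R m n) :=
  [set x | (ratr j.2 < x j.1.1 j.1.2)%R].

Definition rat_box (ab : 'M[rat]_(m, n) * 'M[rat]_(m, n)) : set (Rpow R m n) :=
  [set x | forall i j, (ratr (ab.1 i j) < x i j <= ratr (ab.2 i j))%R].

(** Half-open boxes are used since they are Boolean combinations of the sets
    [halfspace j], hence are determined by finitely many bits of the encoding. *)
Lemma nbhs_rat_box (x : 'M[R]_(m, n)) (A : set 'M[R]_(m, n)) :
  nbhs x A -> exists2 ab, rat_box ab x & rat_box ab `<=` A.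
Proof.
move=> [P Px PA].
have /choice[f fP] : forall ij : 'I_m * 'I_n, exists ab : rat * rat,
    (ratr ab.1 < x ij.1 ij.2 <= ratr ab.2)%R /\
    forall y, (ratr ab.1 < y <= ratr ab.2)%R -> P ij.1 ij.2 y.
  move=> [i j] /=; have /nbhs_ballP[e /= e0 eP] := Px i j.
  have [a] := @rat_in_itvoo R (x i j - e)%R (x i j) ltac:(by rewrite ltrBlDr ltrDl).
  have [b] := @rat_in_itvoo R (x i j) (x i j + e)%R ltac:(by rewrite ltrDl).
  rewrite !in_itv /= => /andP[xb be] /andP[ea ax].
  exists (a, b) => /=; rewrite ax ltW //; split=> // y /andP[ay yb]; apply: eP.
  rewrite /ball /= ltr_distlC; apply/andP; split.
    exact: lt_trans ea ay.
  exact: le_lt_trans yb be.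
exists (\matrix_(i, j) (f (i, j)).1, \matrix_(i, j) (f (i, j)).2).
  by move=> i j; rewrite !mxE; have [] := fP (i, j).
by move=> y yP; apply: PA => i j; have := yP i j; rewrite !mxE; have [_] := fP (i, j); apply.
Qed.

Lemma measurable_halfspace j : measurable (halfspace j).
Proof.
apply: sub_sigma_algebra => /=.
have -> : halfspace j = (fun x : 'M[R]_(m, n) => x j.1.1 j.1.2) @^-1` `]ratr j.2, +oo[.
  by apply/seteqP; split=> x /=; rewrite in_itv /= andbT.
apply: open_comp; last exact: interval_open.
by move=> x _; exact: coord_continuous.
Qed.

(** An open set is the union of the rational boxes that it contains, and there
    are countably many of them. *)
Lemma Rpow_halfspaces : @measurable _ (Rpow R m n) = <<s range halfspace>>.
Proof.
apply/seteqP; split; last first.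
  apply: smallest_sub; first exact: sigma_algebra_measurable.
  by move=> _ [j _ <-]; exact: measurable_halfspace.
apply: smallest_sub; first exact: smallest_sigma_algebra.
move=> U oU.
pose T := g_sigma_algebraType (range halfspace).
have -> : U = \bigcup_ab (if pselect (rat_box ab `<=` U) then rat_box ab else set0).
  apply/seteqP; split=> [x Ux|x [ab _]]; last by case: pselect => // s /s.
  have [|ab abx abU] := @nbhs_rat_box x U; first exact: open_nbhs_nbhs.
  by exists ab => //; case: pselect.
suff mbox ab : @measurable _ T (rat_box ab).
  apply: (@countable_bigcupT_measurable _ T) => //.
  by move=> ab; case: pselect => [?|?] /=; first exact: mbox.
have -> : rat_box ab = \bigcap_(ij in setT)
    (halfspace (ij, ab.1 ij.1 ij.2) `\` halfspace (ij, ab.2 ij.1 ij.2)).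
  apply/seteqP; split=> [x xab [i j] _|x xab i j] /=.
    by have /andP[xa xb] := xab i j; split=> //; apply/negP; rewrite -leNgt.
  by have [/= -> /negP] := xab (i, j) I; rewrite /halfspace /= -leNgt.
apply: (@fin_bigcap_measurable _ T) => // ij _.
by apply: (@measurableD _ T); apply: sub_sigma_algebra; exact: imageT.
Qed.

Lemma measurable_fun_Rpow d (T : measurableType d) (f : T -> Rpow R m n) :
  (forall i j, measurable_fun setT (fun x => f x i j)) -> measurable_fun setT f.
Proof.
move=> mf; apply: (measurability (range halfspace)).
  exact: Rpow_halfspaces.
move=> _ [_ [j _ <-] <-]; rewrite setTI.
have -> : f @^-1` halfspace j = setT `&` (fun x => f x j.1.1 j.1.2) @^-1` `]ratr j.2, +oo[.
  by rewrite setTI; apply/seteqP; split=> x /=; rewrite in_itv /= andbT.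
exact: mf.
Qed.

Lemma measurable_continuous (c : 'M[R]_(m, n) -> R) :
  continuous c -> measurable_fun [set: Rpow R m n] c.
Proof.
move=> cc; apply: (measurability (@RGenOInfty.G R)).
  exact: RGenOInfty.measurableE.
move=> _ [_ [a ->] <-]; rewrite setTI; apply: sub_sigma_algebra.
by apply: open_comp => [x _|]; [exact: cc|exact: interval_open].
Qed.

Lemma measurable_coord i j : measurable_fun setT (fun x : Rpow R m n => x i j).
Proof. by apply: measurable_continuous; exact: coord_continuous. Qed.

(** The lower bounds range over a list rather than over one rational for each
    coordinate, so that concatenation gives closure under intersection and the
    halfspaces themselves are orthants. *)
Definition orthant (s : seq ('I_m * 'I_n * rat)) : set (Rpow R m n) :=
  [set x | all (fun j => ratr j.2 < x j.1.1 j.1.2)%R s].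

Lemma orthantE s : orthant s = \big[setI/setT]_(j <- s) halfspace j.
Proof.
elim: s => [|j s IH]; first by rewrite big_nil; apply/seteqP.
rewrite big_cons -IH; apply/seteqP; split=> x /=.
  by rewrite /orthant /= => /andP[].
by move=> [? ?]; apply/andP.
Qed.

Lemma measurable_orthant s : measurable (orthant s).
Proof.
by rewrite orthantE; apply: bigsetI_measurable => j _; exact: measurable_halfspace.
Qed.

Lemma eq_law_orthant (P Q : probability (Rpow R m n) R) :
  (forall s, P (orthant s) = Q (orthant s)) -> same_law P Q.
Proof.
move=> PQ B mB.
apply: (measure_unique (range orthant) (fun=> setT)) => //.
- rewrite Rpow_halfspaces; apply/seteqP; split.
    apply: smallest_sub; first exact: smallest_sigma_algebra.
    move=> _ [j _ <-]; apply: sub_sigma_algebra; exists [:: j] => //.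
    by rewrite orthantE big_seq1.
  rewrite -Rpow_halfspaces; apply: smallest_sub; first exact: sigma_algebra_measurable.
  by move=> _ [s _ <-]; exact: measurable_orthant.
- move=> _ _ [s _ <-] [s' _ <-]; exists (s ++ s') => //.
  by rewrite !orthantE big_cat.
- by move=> _; exists [::] => //; rewrite orthantE big_nil.
- by rewrite bigcup_const.
- by move=> _ [s _ <-]; exact: PQ.
- by move=> _; rewrite (le_lt_trans (probability_le1 _ _)) ?ltry.
Qed.

End BorelRpow.

(** * Random bits with prescribed prefix weights *)

Lemma probability_of_measure (R : realType) d (T : measurableType d)
    (m : {measure set T -> \bar R}) :
  m setT = 1 -> exists P : probability T R, forall A, P A = m A.
Proof.
move=> m1; exists (mnormalize m (\d_point)) => A.
by rewrite /= /mnormalize m1 onee_eq0 /= invr1 mule1.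
Qed.

Section BitsOfWeights.
Context {R : realType}.
Variable p : seq bool -> R.
Hypothesis p_ge0 : forall w, (0 <= p w)%R.
Hypothesis p_nil : p [::] = 1%R.
Hypothesis p_split : forall w, p w = (p (false :: w) + p (true :: w))%R.

(** Words are written with the latest bit first. The words of length [k] cut
    [0, 1) into consecutive intervals of lengths [p w], and the interval of [w]
    is split between those of [false :: w] and [true :: w], in this order; this
    is its left endpoint. *)
Fixpoint cell_left (w : seq bool) : R :=
  if w is b :: w' then (cell_left w' + (if b then p (false :: w') else 0))%R else 0%R.

(** For [x] in [0, 1) this is the word of length [k] whose interval contains [x]. *)
Fixpoint cell_word (k : nat) (x : R) : seq bool :=
  if k is k'.+1 then
    let w := cell_word k' x in (cell_left w + p (false :: w) <= x)%R :: w
  else [::].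

Definition cell_bit (k : nat) (x : R) : bool := head false (cell_word k.+1 x).

Lemma cell_wordE k x : cell_word k x = rev (mkseq (cell_bit^~ x) k).
Proof. by elim: k => // k IH; rewrite mkseqS rev_rcons -IH. Qed.

Lemma size_cell_word k x : size (cell_word k x) = k.
Proof. by rewrite cell_wordE size_rev size_mkseq. Qed.

Lemma cell_wordP w (x : R) : (0 <= x < 1)%R ->
  (cell_word (size w) x == w) = (cell_left w <= x < cell_left w + p w)%R.
Proof.
move=> x01; elim: w => [|b w IH] /=; first by rewrite p_nil add0r x01 eqxx.
rewrite eqseq_cons andbC; have [wE|neq] := eqVneq (cell_word (size w) x) w.
  move: IH; rewrite wE eqxx => /esym/andP[xl xr] /=.
  case: b; rewrite ?addr0.
    by rewrite eqb_id -addrA -p_split xr andbT.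
  by rewrite xl /= eqbF_neg -ltNge.
rewrite andFb; move: IH; rewrite (negbTE neq) => /esym/negbT neqw.
apply/esym; apply: contraNF neqw => /andP[xl xr].
have := p_ge0 (true :: w); have := p_ge0 (false :: w).
have pD := p_split w.
by case: b xl xr => xl xr t0 f0; apply/andP; split; lra.
Qed.

Lemma measurable_cell_word w : measurable [set x : R | cell_word (size w) x = w].
Proof.
elim: w => [|b w IH]; first by rewrite (_ : mkset _ = setT) //; apply/seteqP.
have -> : [set x | cell_word (size (b :: w)) x = b :: w] =
    [set x | cell_word (size w) x = w] `&`
    [set x | (cell_left w + p (false :: w) <= x)%R = b].
  apply/seteqP; split=> x /=.
    by case=> + wE; rewrite wE.
  by case=> wE; rewrite wE => ->.
apply: measurableI => //.
have mi : measurable `[(cell_left w + p (false :: w))%R, +oo[%classic by [].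
case: b.
  rewrite (_ : mkset _ = `[(cell_left w + p (false :: w))%R, +oo[%classic) //.
  by apply/seteqP; split=> x; rewrite /= in_itv /= andbT.
rewrite (_ : mkset _ = ~` `[(cell_left w + p (false :: w))%R, +oo[%classic); first exact: measurableC.
apply/seteqP; split=> x /=; rewrite in_itv /= andbT.
  by move=> ->.
by move=> /negP/negbTE.
Qed.

Lemma measurable_cell_bit k : measurable_fun setT (cell_bit k).
Proof.
apply: (measurable_fun_bool true).
have -> : setT `&` cell_bit k @^-1` [set true] =
    \bigcup_(w : k.+1.-tuple bool) (if head false w then [set x | cell_word (size w) x = w] else set0).
  apply/seteqP; split=> [x [_ hx]|x [w _]].
    have sw : size (cell_word k.+1 x) == k.+1 by rewrite size_cell_word.
    exists (Tuple sw) => //.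
    have -> : head false (Tuple sw) = true by exact: hx.
    by rewrite /mkset size_tuple.
  by case: ifP => // hw /= wE; split=> //=; move: hw; rewrite -wE size_tuple.
apply: countable_bigcupT_measurable => // w.
by case: ifP => // _; exact: measurable_cell_word.
Qed.

End BitsOfWeights.

(** Kolmogorov's extension theorem for bits: reading off in which of the nested
    intervals of lengths [p w] a uniform point of [0, 1) falls turns consistent
    weights into random bits, without extending a measure. *)
Lemma bits_of_weights (R : realType) (p : seq bool -> R) :
  (forall w, 0 <= p w)%R -> p [::] = 1%R ->
  (forall w, p w = p (false :: w) + p (true :: w))%R ->
  exists d (T : measurableType d) (P : probability T R) (b : nat -> T -> bool),
    (forall k, measurable_fun setT (b k)) /\
    forall w, P [set x | rev (mkseq (b^~ x) (size w)) = w] = (p w)%:E.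
Proof.
move=> p0 p1 pD.
have mI : measurable (`[0%R, 1%R[%classic : set (measurableTypeR R)) by [].
pose P0 : {measure set (measurableTypeR R) -> \bar R} := mrestr (@lebesgue_measure R) mI.
have P01 : P0 setT = 1.
  by rewrite /P0 /= /mrestr setTI lebesgue_measure_itv /= lte_fin ltr01 oppr0 adde0.
have [P PE] := probability_of_measure P01.
exists _, (measurableTypeR R), P, (cell_bit p); split; first exact: measurable_cell_bit.
move=> w; rewrite PE /= /mrestr.
suff -> : [set x | rev (mkseq ((cell_bit p)^~ x) (size w)) = w] `&` `[0%R, 1%R[ =
    `[cell_left p w, (cell_left p w + p w)%R[%classic.
  rewrite /= lebesgue_measure_itv /= lte_fin ltrDl.
  case: ltP => [_|pw0]; first by rewrite -EFinD addrAC subrr add0r.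
  by congr _%:E; apply/eqP; rewrite eq_le p0.
have lw : (0 <= cell_left p w)%R /\ (cell_left p w + p w <= 1)%R.
  elim: w => [|b w [IH1 IH2]] /=; first by rewrite p1 add0r.
  have := p0 (false :: w); have := p0 (true :: w); have := pD w.
  by case: b => *; split; lra.
apply/seteqP; split=> x /=; rewrite !in_itv /=.
  by move=> [wE x01]; rewrite -cell_wordP // cell_wordE wE.
move=> xw; have x01 : (0 <= x < 1)%R.
  by case/andP: xw => ? ?; apply/andP; split; lra.
by split=> //; move: xw; rewrite -cell_wordP // cell_wordE => /eqP.
Qed.

(** * Limits of the laws of countable families of events *)

Lemma measurable_event d (T : measurableType d) (f : T -> bool) :
  measurable_fun setT f -> measurable [set x | f x].
Proof. by move=> mf; rewrite -[X in measurable X]setTI; exact: (mf _ [set true]). Qed.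

Lemma measurable_map_fun d (T : measurableType d) (J : Type) (b : J -> T -> bool) :
  (forall j, measurable_fun setT (b j)) ->
  forall d' (U : measurableType d') (g : seq bool -> U) (s : seq J),
  measurable_fun setT (fun x => g (map (b^~ x) s)).
Proof.
move=> mb d' U g s; elim: s g => [|j s IH] g; first by rewrite /=; exact: measurable_cst.
rewrite (_ : (fun x => _) = (fun x => if b j x then g (true :: map (b^~ x) s)
                                      else g (false :: map (b^~ x) s))).
  by apply: measurable_fun_ifT => //; apply: (IH (fun v => g (_ :: v))).
by apply/funext => x /=; case: (b j x).
Qed.

Section PrefixIntegral.
Context {R : realType} d (T : measurableType d) (b : nat -> T -> bool).
Hypothesis mb : forall k, measurable_fun setT (b k).

Lemma measurable_prefix k (w : seq bool) :
  measurable [set x | mkseq (b^~ x) k = w].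
Proof.
have := measurable_event (measurable_map_fun mb (fun v => v == w) (iota 0 k)).
by congr measurable; apply/seteqP; split=> x /= /eqP.
Qed.

Lemma prefix_funE k (g : seq bool -> R) (x : T) :
  g (mkseq (b^~ x) k) = (\sum_(w : k.-tuple bool)
     g w * \1_[set y | mkseq (b^~ y) k = w] x)%R.
Proof.
have sw : size (mkseq (b^~ x) k) == k by rewrite size_mkseq.
rewrite (bigD1 (Tuple sw)) //= big1 ?addr0 => [|w wneq].
  by rewrite indicE mem_set // mulr1.
rewrite indicE memNset ?mulr0 //= => wE; case/eqP: wneq.
exact: val_inj.
Qed.

Lemma integral_prefix (m : {measure set T -> \bar R}) k (g : seq bool -> R) :
  (forall w, 0 <= g w)%R ->
  \int[m]_x (g (mkseq (b^~ x) k))%:E =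
  \sum_(w : k.-tuple bool) (g w)%:E * m [set x | mkseq (b^~ x) k = w].
Proof.
move=> g0; under eq_integral do rewrite prefix_funE -sumEFin.
have mi w : measurable_fun setT
    (fun x => (\1_[set y | mkseq (b^~ y) k = w] x)%:E : \bar R).
  by apply/measurable_EFinP/measurable_indic; exact: measurable_prefix.
rewrite ge0_integral_sum //.
- apply: eq_bigr => w _; under eq_integral do rewrite EFinM.
  rewrite ge0_integralZl_EFin // integral_indic ?setIT //.
  exact: measurable_prefix.
- by move=> w; under eq_fun do rewrite EFinM; apply: measurable_funeM.
- by move=> w x _; rewrite lee_fin mulr_ge0 // indicE.
Qed.

End PrefixIntegral.

(** A cluster point of an ultrafilter is a limit; the filter of the values of [u]
    need not be an ultrafilter unless [u] is onto, so the dichotomy is applied to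
    preimages. *)
Lemma ultra_cvg_segment (R : realType) (U : set_system nat) (u : nat -> R) :
  UltraFilter U -> (forall n, 0 <= u n <= 1)%R ->
  exists l : R, u n @[n --> U] --> l.
Proof.
move=> UU u01.
have [l [_ cl]] : exists l : R, (`[0%R, 1%R]%classic `&` cluster (u n @[n --> U])) l.
  apply: segment_compact; apply: (@filterE _ U) => n.
  by rewrite /= in_itv /= u01.
exists l => A lA; have [//|UA] := in_ultra_setVsetC (u @^-1` A) UU.
by have [x []] := cl (~` A) A UA lA.
Qed.

(** A function of [k] bits has as integral a finite combination of prefix
    probabilities, so its integral passes to the ultrafilter limit. The limit
    process is characterized by its upper bounds only, which keeps the
    ultrafilter out of the statement. *)
Lemma limit_bits (R : realType) d (T : measurableType d)
    (Q : nat -> probability T R) (e : nat -> T -> bool) :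
  (forall k, measurable_fun setT (e k)) ->
  exists d' (T' : measurableType d') (P : probability T' R) (b : nat -> T' -> bool),
    (forall k, measurable_fun setT (b k)) /\
    forall k (g : seq bool -> R) (L : R), (forall w, 0 <= g w)%R ->
      (\forall n \near \oo, \int[Q n]_x (g (mkseq (e^~ x) k))%:E <= L%:E) ->
      \int[P]_x (g (mkseq (b^~ x) k))%:E <= L%:E.
Proof.
move=> me; have [U [UU ooU]] := @ultraFilterLemma nat \oo _.
pose cyl w := [set x | mkseq (e^~ x) (size w) = rev w].
have mcyl w : measurable (cyl w) by exact: measurable_prefix.
pose q n w := fine (Q n (cyl w)).
have qE n w : (q n w)%:E = Q n (cyl w) by rewrite fineK // fin_num_measure.
have q01 n w : (0 <= q n w <= 1)%R.
  by rewrite -!lee_fin qE measure_ge0 probability_le1.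
have /choice[p qp] w : exists l : R, q n w @[n --> U] --> l.
  by apply: ultra_cvg_segment => // n; exact: q01.
have p0 w : (0 <= p w)%R.
  apply: (ler_cvg_to (@cvg_cst _ 0%R _ U _) (qp w)); apply: filterE => n.
  by case/andP: (q01 n w).
have p1 : p [::] = 1%R.
  apply: (cvg_unique _ (qp [::])) => //.
  rewrite (_ : q^~ [::] = cst 1%R); first exact: cvg_cst.
  apply/funext => n; apply: EFin_inj; rewrite qE.
  by rewrite (_ : cyl [::] = setT) ?probability_setT //; apply/seteqP; split.
have pD w : p w = (p (false :: w) + p (true :: w))%R.
  apply: (cvg_unique _ (qp w)) => //.
  rewrite (_ : q^~ w = q^~ (false :: w) \+ q^~ (true :: w))%R; first exact: cvgD.
  apply/funext => n; apply: EFin_inj; rewrite EFinD !qE -measureU //.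
    congr (Q n _); apply/seteqP; split=> x; rewrite /cyl /= mkseqS !rev_cons.
      by case: (e _ x) => ->; [right|left].
    by case=> /rcons_inj[].
  apply/seteqP; split=> x //; rewrite /cyl /= mkseqS !rev_cons.
  by case=> /rcons_inj[_ ->] /rcons_inj[].
have [d' [T' [P [b [mb Pb]]]]] := bits_of_weights p0 p1 pD.
exists d', T', P, b; split=> // k g L g0 gL.
have Pcyl w : P [set x | mkseq (b^~ x) (size w) = w] = (p (rev w))%:E.
  rewrite -Pb size_rev; congr (P _); apply/seteqP; split=> x /=; first by move->.
  exact: (can_inj revK).
have -> : \int[P]_x (g (mkseq (b^~ x) k))%:E =
    (\sum_(w : k.-tuple bool) g w * p (rev w))%:E.
  rewrite integral_prefix // -sumEFin; apply: eq_bigr => w _.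
  by rewrite EFinM -Pcyl size_tuple.
rewrite lee_fin.
have cv : (\sum_(w : k.-tuple bool) g w * q n (rev w) @[n --> U] -->
           \sum_(w : k.-tuple bool) g w * p (rev w))%R.
  apply: cvg_big => [|w _]; first exact: add_continuous.
  by apply: cvgMr; exact: qp.
apply: (ler_cvg_to cv (@cvg_cst _ L _ U _)).
apply: filterS (ooU _ gL) => n; rewrite integral_prefix //.
rewrite -lee_fin; congr (_ <= _); rewrite -sumEFin; apply: eq_bigr => w _.
by rewrite EFinM qE /cyl revK size_rev size_tuple.
Qed.

Section BitFamilies.
Context {R : realType} (J : countType).

(** The law of each finite subfamily of [b] under [P] is a limit point of the laws
    of the corresponding subfamilies of [h] under [Q]. Stated by upper bounds on
    integrals, this is visibly stable under almost sure modification of [b]. *)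
Definition bits_limit d (T : measurableType d) (Q : nat -> probability T R)
    (h : J -> T -> bool) d' (T' : measurableType d') (P : probability T' R)
    (b : J -> T' -> bool) :=
  forall (s : seq J) (g : seq bool -> R) (L : R), (forall w, 0 <= g w)%R ->
    (\forall n \near \oo, \int[Q n]_x (g (map (h^~ x) s))%:E <= L%:E) ->
    \int[P]_x (g (map (b^~ x) s))%:E <= L%:E.

Lemma limit_bit_family d (T : measurableType d) (Q : nat -> probability T R)
    (h : J -> T -> bool) :
  (forall j, measurable_fun setT (h j)) ->
  exists d' (T' : measurableType d') (P : probability T' R) (b : J -> T' -> bool),
    (forall j, measurable_fun setT (b j)) /\ bits_limit Q h P b.
Proof.
move=> mh; pose e k := if unpickle k is Some j then h j else cst false.
have [|d' [T' [P [b [mb Pb]]]]] := @limit_bits R _ T Q e.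
  by move=> k; rewrite /e; case: unpickle.
exists d', T', P, (b \o pickle); split=> [j|s g L g0 gL]; first exact: mb.
pose k := (\max_(j <- s) (pickle j).+1)%N.
have mapE (f : nat -> bool) : map (f \o pickle) s =
    map (nth false (mkseq f k)) (map pickle s).
  rewrite -map_comp; apply/eq_in_map => j js /=.
  by rewrite nth_mkseq //; exact: (@leq_bigmax_seq _ _ xpredT (fun j => (pickle j).+1)).
have := Pb k (fun w => g (map (nth false w) (map pickle s))) L (fun=> g0 _).
under eq_integral do rewrite -(mapE (b^~ _)).
apply; apply: filterS gL => n; congr (_ <= _); apply: eq_integral => x _.
by rewrite -(mapE (e^~ x)); congr (g _)%:E; apply: eq_map => j /=; rewrite /e pickleK.
Qed.

Lemma integral_pred d (T : measurableType d) (m : {measure set T -> \bar R})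
    (f : T -> bool) : measurable_fun setT f ->
  \int[m]_x ((f x)%:R : R)%:E = m [set x | f x].
Proof.
move=> mf; have mA := measurable_event mf.
rewrite -[in RHS](setIT [set x | f x]) -integral_indic //; apply: eq_integral => x _.
by rewrite indicE; congr (_%:R)%:E; congr nat_of_bool; apply/idP/idP => [?|/set_mem//]; exact/mem_set.
Qed.

(** An event of constant probability keeps it in the limit: apply the upper bound
    to the event and to its complement. *)
Lemma bits_limit_event d (T : measurableType d) (Q : nat -> probability T R)
    (h : J -> T -> bool) d' (T' : measurableType d') (P : probability T' R)
    (b : J -> T' -> bool) :
  (forall j, measurable_fun setT (h j)) -> (forall j, measurable_fun setT (b j)) ->
  bits_limit Q h P b ->
  forall (s : seq J) (p : pred (seq bool)) (v : \bar R),
    (forall n, Q n [set x | p (map (h^~ x) s)] = v) ->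
    P [set x | p (map (b^~ x) s)] = v.
Proof.
move=> mh mb lim s p v Qv.
have mPp := measurable_event (measurable_map_fun mb p s).
have mQp := measurable_event (measurable_map_fun mh p s).
have vfin : v \is a fin_num by rewrite -(Qv 0%N) fin_num_measure.
have le_event (p' : pred (seq bool)) v' : v' \is a fin_num ->
    (forall n, Q n [set x | p' (map (h^~ x) s)] = v') ->
    P [set x | p' (map (b^~ x) s)] <= v'.
  move=> v'fin Qv'; rewrite -integral_pred; last exact: measurable_map_fun.
  rewrite -(fineK v'fin); apply: (lim s (fun w => (p' w)%:R) (fine v')) => //.
  apply: nearW => n; rewrite integral_pred; last exact: measurable_map_fun.
  by rewrite [leLHS]Qv' fineK.
have setCE (I : Type) (f : I -> bool) : [set x | ~~ f x] = ~` [set x | f x].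
  by apply/seteqP; split=> x /= /negP.
apply/eqP; rewrite eq_le le_event //=.
have : P [set x | ~~ p (map (b^~ x) s)] <= 1 - v.
  apply: (le_event (fun w => ~~ p w)) => [|n]; first by rewrite fin_numB vfin.
  by rewrite (setCE _ (fun x => p (map (h^~ x) s))) probability_setC // Qv.
rewrite (setCE _ (fun x => p (map (b^~ x) s))) probability_setC //.
by rewrite leeD2lE // leeN2.
Qed.

End BitFamilies.

(** * Recovering reals from rational cuts *)

Section RationalCuts.
Context {R : realType}.

Definition cut_sup (B : rat -> bool) : \bar R :=
  ereal_sup [set (ratr q)%:E | q in [set q | B q]].

Lemma cut_supP (B : rat -> bool) :
  (exists q, B q) -> (exists q, ~~ B q) ->
  (forall q q', (q < q')%R -> B q' -> B q) ->
  (forall q, B q -> exists2 q', (q < q')%R & B q') ->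
  forall q, B q = (ratr q < fine (cut_sup B))%R.
Proof.
move=> [q0 Bq0] [q1 nBq1] down open_up q.
have ub : cut_sup B <= (ratr q1)%:E.
  apply: ge_ereal_sup => _ [r Br <-]; rewrite lee_fin ler_rat leNgt.
  by apply/negP => /down/(_ Br); rewrite (negbTE nBq1).
have lb r : B r -> (ratr r)%:E <= cut_sup B.
  by move=> Br; apply: ereal_sup_ubound; exists r.
have fin : cut_sup B \is a fin_num.
  by rewrite fin_numE gt_eqF ?lt_eqF // (le_lt_trans ub (ltry _), lt_le_trans (ltNyr _) (lb _ Bq0)).
rewrite -lte_fin fineK //; apply/idP/idP => [/open_up[r qr /lb]|].
  by apply: lt_le_trans; rewrite lte_fin ltr_rat.
by move=> /ereal_sup_gt[_ [r Br <-]]; rewrite lte_fin ltr_rat => /down; apply.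
Qed.

Lemma measurable_cut_sup d (T : measurableType d) (b : rat -> T -> bool) :
  (forall q, measurable_fun setT (b q)) ->
  measurable_fun setT (fun x => cut_sup (b^~ x)).
Proof.
move=> mb.
pose f k x : \bar R := if unpickle k is Some q then
  (if b q x then (ratr q)%:E else -oo) else -oo.
rewrite (_ : (fun x => _) = (fun x => esups (f^~ x) 0%N)).
  apply: measurable_fun_esups => k; rewrite /f; case: unpickle => // q.
  exact: measurable_fun_ifT.
apply/funext => x; apply/eqP; rewrite eq_le; apply/andP; split.
  apply: ge_ereal_sup => _ [q bq <-]; apply: ereal_sup_ubound.
  by exists (pickle q) => //=; rewrite /f pickleK bq.
apply: ge_ereal_sup => _ [k _ <-]; rewrite /f; case: unpickle => [q|]; last exact: leNye.
by case: ifP => bq; [apply: ereal_sup_ubound; exists q | exact: leNye].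
Qed.

End RationalCuts.

Lemma ae_forall_count (R : realType) d (T : measurableType d)
    (mu : {measure set T -> \bar R}) (J : countType) (A : J -> T -> Prop) :
  (forall j, {ae mu, forall x, A j x}) -> {ae mu, forall x, forall j, A j x}.
Proof.
move=> Aj.
have := @ae_foralln _ _ _ mu (fun k x => if unpickle k is Some j then A j x else True).
case=> [k|N [mN N0 sN]]; first by case: unpickle => [j|]; [exact: Aj|exact: aeW].
exists N; split=> // x /= nA; apply: sN => /= allA; apply: nA => j.
by have := allA (pickle j); rewrite pickleK.
Qed.

(** If the events [E k] have the probabilities of sets decreasing to the empty
    set, almost every point avoids some [E k]: this transfers countable
    additivity of the marginals to the limit bits, for which only finitely many
    bits at a time are controlled. *)
Lemma null_shrinking (R : realType) d (T : measurableType d) (P : probability T R)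
    d' (T' : measurableType d') (nu : probability T' R)
    (E : nat -> set T) (F : nat -> set T') :
  (forall k, measurable (E k)) -> (forall k, measurable (F k)) ->
  {homo F : i j / (i <= j)%N >-> (j <= i)%O} -> \bigcap_k F k = set0 ->
  (forall k, P (E k) = nu (F k)) -> {ae P, forall x, exists k, ~ E k x}.
Proof.
move=> mE mF dF F0 PE.
have mcap : measurable (\bigcap_k E k) by exact: bigcapT_measurable.
exists (\bigcap_k E k); split=> //; last first.
  by move=> x /= /forallNP nE k _; apply: contrapT; exact: nE.
apply/eqP; rewrite eq_le measure_ge0 andbT.
have := @nonincreasing_cvg_mu _ _ _ nu F _ mF _ dF; rewrite F0 measure0.
case/(_ _ _)/wrap => [||cv].
- by rewrite (le_lt_trans (probability_le1 _ _)) ?ltry.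
- exact: measurable0.
have /cvg_lim <- // := cv.
apply: lime_ge; first by apply/cvg_ex; eexists; exact: cv.
apply: nearW => k /=; rewrite -PE; apply: le_measure; rewrite ?inE //.
exact: bigcap_inf.
Qed.

(** * Sequential compactness of multicouplings *)

Section Multicouplings.
Context {R : realType} {m n : nat}.

Definition above (j : 'I_m * 'I_n * rat) (y : Rpow R m n) : bool :=
  (ratr j.2 < y j.1.1 j.1.2)%R.

Lemma measurable_above j : measurable_fun setT (above j).
Proof.
apply: (measurable_fun_bool true); rewrite setTI.
exact: measurable_halfspace j.
Qed.

Let nat_above (x : R) : exists k : nat, (x < k%:R)%R.
Proof. by exists (Num.bound `|x|%R); rewrite (le_lt_trans (ler_norm x)) ?archi_boundP. Qed.

Variables (Q : nat -> probability (Rpow R m n) R) (mu : 'I_m -> probability (Rpow R 1 n) R).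
Hypothesis margQ : forall k i, same_law (distribution (Q k) (component i)) (mu i).

Section Bits.
Context d (T : measurableType d) (P : probability T R) (b : 'I_m * 'I_n * rat -> T -> bool).
Hypothesis mb : forall j, measurable_fun setT (b j).
Hypothesis limb : bits_limit Q above P b.

Let rowb i (cq : 'I_n * rat) (x : T) : bool := b (i, cq.1, cq.2) x.
Let rowz (cq : 'I_n * rat) (z : Rpow R 1 n) : bool := (ratr cq.2 < z 0%R cq.1)%R.

Let measurable_rowz cq : measurable_fun setT (rowz cq).
Proof.
apply: (measurable_fun_bool true); rewrite setTI.
exact: (@measurable_halfspace R 1 n (0%R, cq.1, cq.2)).
Qed.

(** Events on the bits of one row have the same probability under all [Q k],
    given by the marginal [mu i]. *)
Lemma row_event i (s : seq ('I_n * rat)) (p : pred (seq bool)) :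
  P [set x | p (map (rowb i ^~ x) s)] = mu i [set z | p (map (rowz ^~ z) s)].
Proof.
have mz := measurable_event (measurable_map_fun measurable_rowz p s).
pose s' := [seq (i, cq.1, cq.2) | cq <- s].
rewrite (_ : mkset _ = [set x | p (map (b^~ x) s')]); last first.
  by apply/funext => x; rewrite /mkset /s' -map_comp.
apply: (bits_limit_event measurable_above mb limb) => k.
rewrite -(margQ k i) // /distribution /pushforward /=.
congr (Q k _); apply/funext => y; rewrite /mkset /s' /preimage /= -map_comp.
by congr (is_true (p _)); apply: eq_map => cq /=; rewrite /rowz /above mxE.
Qed.

Let row_null i (s : nat -> seq ('I_n * rat)) (p : pred (seq bool)) :
  (forall z k l, (k <= l)%N -> p (map (rowz^~ z) (s l)) -> p (map (rowz^~ z) (s k))) ->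
  (forall z, exists k, ~~ p (map (rowz^~ z) (s k))) ->
  {ae P, forall x, exists k, ~~ p (map (rowb i ^~ x) (s k))}.
Proof.
move=> dec none.
have := @null_shrinking R _ _ P _ _ (mu i)
  (fun k => [set x | p (map (rowb i ^~ x) (s k))])
  (fun k => [set z | p (map (rowz ^~ z) (s k))]).
case/(_ _ _ _ _ _)/wrap.
- by move=> k; apply: measurable_event; apply: measurable_map_fun => cq; exact: mb.
- by move=> k; apply: measurable_event; exact: measurable_map_fun.
- by move=> k l kl; apply/subsetPset => z /=; exact: dec.
- apply/seteqP; split=> // z /= allz; have [k] := none z.
  by rewrite (allz k I).
- by move=> k; exact: row_event.
by apply: filterS => x [k /negP pk]; exists k.
Qed.

Definition decode (x : T) : Rpow R m n :=
  \matrix_(i, c) fine (cut_sup (fun q => b (i, c, q) x)).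

Lemma measurable_decode : measurable_fun setT decode.
Proof.
apply: measurable_fun_Rpow => i c; under eq_fun do rewrite mxE.
apply: measurableT_comp; first exact: fine_measurable.
exact: measurable_cut_sup.
Qed.

(** The bits of each coordinate are almost surely the rational cut of a real
    number, because each defining property of such cuts fails only on a set
    whose marginal counterparts shrink to the empty set. *)
Lemma decode_ae : {ae P, forall x, forall j, b j x = above j (decode x)}.
Proof.
(* not empty: the lower bounds -k are eventually met *)
have aeA : {ae P, forall x, forall ic : 'I_m * 'I_n, exists q, b (ic, q) x}.
  apply: ae_forall_count => -[i c].
  have := @row_null i (fun k => [:: (c, - k%:R)%R]) (fun w => ~~ head true w).
  case/(_ _ _)/wrap.
  - move=> z k l kl; rewrite /= /rowz /= -!leNgt => zl; apply: le_trans zl _.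
    by rewrite ler_rat lerN2 ler_nat.
  - move=> z; have [k zk] := nat_above (- z 0%R c)%R.
    by exists k; rewrite negbK /= /rowz /= raddfN /= ratr_nat ltrNl.
  by apply: filterS => x [k]; rewrite negbK /= => bk; exists (- k%:R)%R.
(* not full *)
have aeB : {ae P, forall x, forall ic : 'I_m * 'I_n, exists q, ~~ b (ic, q) x}.
  apply: ae_forall_count => -[i c].
  have := @row_null i (fun k => [:: (c, k%:R)%R]) (fun w => head false w).
  case/(_ _ _)/wrap.
  - move=> z k l kl; rewrite /= /rowz /=; apply: le_lt_trans.
    by rewrite ler_rat ler_nat.
  - move=> z; have [k zk] := nat_above (z 0%R c).
    by exists k; rewrite /= /rowz /= ratr_nat -leNgt ltW.
  by apply: filterS => x [k] bk; exists (k%:R)%R.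
(* downward closed *)
have aeC : {ae P, forall x, forall icqq : 'I_m * 'I_n * rat * rat,
    (icqq.1.2 < icqq.2)%R -> b (icqq.1.1, icqq.2) x -> b icqq.1 x}.
  apply: ae_forall_count => -[[[i c] q] q'] /=; have [qq|_] := ltP q q'; last exact: aeW.
  have := @row_null i (fun k => [:: (c, q); (c, q')])
    (fun w => ~~ nth false w 0 && nth false w 1).
  case/(_ _ _)/wrap => //.
  - move=> z; exists 0%N; rewrite /= /rowz /= negb_and negbK.
    by case: ltP => //= qz; rewrite -leNgt (le_trans qz) // ler_rat ltW.
  by apply: filterS => x [_]; rewrite /rowb /= negb_and negbK => /orP[-> //|/negP nb _ /nb].
(* no largest element: try q + 1/(k + 1) *)
have aeD : {ae P, forall x, forall icq : 'I_m * 'I_n * rat, b icq x ->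
    exists2 q', (icq.2 < q')%R & b (icq.1, q') x}.
  apply: ae_forall_count => -[[i c] q] /=.
  have := @row_null i (fun k => [:: (c, q); (c, q + k.+1%:R^-1)%R])
    (fun w => nth false w 0 && ~~ nth false w 1).
  case/(_ _ _)/wrap.
  - move=> z k l kl; rewrite /= /rowz /= => /andP[-> ]; rewrite -!leNgt => /le_trans; apply.
    by rewrite ler_rat lerD2l lef_pV2 ?posrE // ler_nat.
  - move=> z; rewrite /= /rowz /=; case: ltP => qz; last by exists 0%N.
    have [k kz] := ltr_add_invr qz.
    by exists k; rewrite /= negbK rmorphD fmorphV /= ratr_nat.
  apply: filterS => x [k]; rewrite /rowb /= negb_and negbK => /orP[/negP nb /nb //|bk] _.
  by exists (q + k.+1%:R^-1)%R => //; rewrite ltrDl invr_gt0.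
near=> x => -[[i c] q]; rewrite /above /= mxE.
have A : forall ic : 'I_m * 'I_n, exists q, b (ic, q) x by near: x.
have B : forall ic : 'I_m * 'I_n, exists q, ~~ b (ic, q) x by near: x.
have C : forall icqq : 'I_m * 'I_n * rat * rat,
    (icqq.1.2 < icqq.2)%R -> b (icqq.1.1, icqq.2) x -> b icqq.1 x by near: x.
have D : forall icq : 'I_m * 'I_n * rat, b icq x ->
    exists2 q', (icq.2 < q')%R & b (icq.1, q') x by near: x.
apply: (@cut_supP R (fun q => b (i, c, q) x)).
- exact: A.
- exact: B.
- by move=> r r' rr br; apply: (C (i, c, r, r')).
- by move=> r br; have [r' ? ?] := D (i, c, r) br; exists r'.
Unshelve. all: by end_near. Qed.

End Bits.


(** Largest function of the bits [s] below [c]; on words that are the code of no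
    point the infimum of the empty set is 0, which is harmless for [c >= 0]. *)
Definition lower_env (c : Rpow R m n -> R) (s : seq ('I_m * 'I_n * rat)) (w : seq bool) : R :=
  inf [set c y | y in [set y | map (above^~ y) s = w]].

Lemma lower_env_ge0 c s w : (forall y, 0 <= c y)%R -> (0 <= lower_env c s w)%R.
Proof.
move=> c0; rewrite /lower_env.
have [->|/set0P ne] := eqVneq [set c y | y in [set y | map (above^~ y) s = w]] set0.
  by rewrite inf0.
by apply: lb_le_inf => // _ [y _ <-].
Qed.

Lemma lower_env_le c s y : (forall y, 0 <= c y)%R ->
  (lower_env c s (map (above^~ y) s) <= c y)%R.
Proof.
by move=> c0; apply: ge_inf; [exists 0%R => _ [y' _ <-] | exists y].
Qed.

Definition first_codes (k : nat) : seq ('I_m * 'I_n * rat) := pmap unpickle (iota 0 k).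

Lemma mem_first_codes k j : (pickle j < k)%N -> j \in first_codes k.
Proof.
move=> jk; rewrite mem_pmap; apply/mapP; exists (pickle j); last by rewrite pickleK.
by rewrite mem_iota.
Qed.

(** By continuity [c] is above [c y - e] on a rational box around [y], and being
    in this box is decided by the bits at its corners. *)
Lemma lower_env_cvg (c : 'M[R]_(m, n) -> R) y : continuous c -> (forall y, 0 <= c y)%R ->
  lower_env c (first_codes k) (map (above^~ y) (first_codes k)) @[k --> \oo] --> c y.
Proof.
move=> cc c0; apply/cvgrPdist_le => e e0.
have [[a b] /= yab abe] := nbhs_rat_box (cvgr_ge _ (cc y) _ (ltac:(by rewrite ltrBlDr ltrDl) : (c y - e < c y)%R)).
pose K := (\max_(ij : 'I_m * 'I_n)
  maxn (pickle (ij, a ij.1 ij.2)) (pickle (ij, b ij.1 ij.2))).+1.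
exists K => // k /= Kk.
rewrite ger0_norm ?subr_ge0 ?lower_env_le // lerBlDl -lerBlDr.
apply: lb_le_inf; first by exists (c y), y.
move=> _ [y' sy' <-]; apply: abe => i j.
have code q : (pickle (i, j, q) <= maxn (pickle (i, j, a i j)) (pickle (i, j, b i j)))%N ->
    (ratr q < y' i j)%R = (ratr q < y i j)%R.
  move=> qab; move/eq_in_map : sy' => /(_ (i, j, q)); apply; apply: mem_first_codes.
  apply: leq_trans Kk; rewrite ltnS; apply: leq_trans qab _.
  exact: (leq_bigmax (i, j)).
have /andP[ya yb] := yab i j.
by rewrite code ?leq_maxl // ya /= leNgt code ?leq_maxr // -leNgt.
Qed.

(** Sequential compactness of the couplings of the [mu i], with lower
    semicontinuity of nonnegative continuous costs. *)
Theorem multicoupling_limit :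
  exists G : probability (Rpow R m n) R,
    (forall i, same_law (distribution G (component i)) (mu i)) /\
    forall (c : 'M[R]_(m, n) -> R) (L : R), continuous c -> (forall y, 0 <= c y)%R ->
      (\forall k \near \oo, \int[Q k]_y (c y)%:E <= L%:E) -> \int[G]_y (c y)%:E <= L%:E.
Proof.
have [d [T [P [b [mb limb]]]]] := limit_bit_family Q measurable_above.
pose D : {mfun T >-> Rpow R m n} :=
  HB.pack (decode b) (isMeasurableFun.Build _ _ _ _ _ (measurable_decode mb)).
pose G := distribution P D.
have limG : bits_limit Q above G above.
  move=> s g L g0 gL.
  rewrite ge0_integral_distribution //; first last.
  - by move=> y; rewrite lee_fin.
  - by apply/measurable_EFinP; exact: measurable_map_fun measurable_above _ _ _ _.
  rewrite (ae_eq_integral (fun x => (g (map (b^~ x) s))%:E)) //.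
  - exact: limb.
  - apply/measurable_EFinP; apply: (measurableT_comp (f := fun y => g (map (above^~ y) s))).
      exact: measurable_map_fun measurable_above _ _ _ _.
    exact: measurable_decode.
  - by apply/measurable_EFinP; exact: measurable_map_fun.
  - have := decode_ae mb limb; apply: filterS => x bx _ /=.
    by congr (g _)%:E; apply: eq_map => j; rewrite bx.
exists G; split=> [i|c L cc c0 cL].
  apply: eq_law_orthant => s.
  have := row_event (P := G) measurable_above limG i [seq (j.1.2, j.2) | j <- s] (all id).
  rewrite /distribution /pushforward => E.
  transitivity (G [set x | all id [seq above (i, cq.1, cq.2) x | cq <- [seq (j.1.2, j.2) | j <- s]]]).
    congr (G _); apply/funext => y; rewrite /orthant /preimage /mkset /= -map_comp all_map.
    by congr is_true; apply: eq_all => j /=; rewrite mxE.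
  apply: (etrans E); congr (mu i _); apply/funext => y; rewrite /orthant /mkset -map_comp all_map.
  by congr is_true; apply: eq_all => j /=; rewrite (ord1 j.1.1).
have mc := measurable_continuous cc.
pose f k (y : Rpow R m n) := lower_env c (first_codes k) (map (above^~ y) (first_codes k)).
have mf k : measurable_fun setT (fun y => (f k y)%:E).
  by apply/measurable_EFinP; exact: measurable_map_fun measurable_above _ _ _ _.
have f0 k y : (0 <= f k y)%R by exact: lower_env_ge0.
have -> : \int[G]_y (c y)%:E = \int[G]_y limn_einf (fun k => (f k y)%:E).
  apply: eq_integral => y _; apply/esym.
  by apply: (cvg_limn_einf_sup _).1; apply: cvg_EFin; [exact: nearW|exact: lower_env_cvg].
apply: le_trans (fatou G measurableT mf _) _; first by move=> k y _; rewrite lee_fin.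
apply: le_trans (limn_einf_sup _) _.
rewrite limn_esup_lim; apply: lime_le; first exact: is_cvg_esups.
apply: nearW => k; apply: ge_ereal_sup => _ [l _ <-].
apply: limG => [w|]; first exact: lower_env_ge0.
apply: filterS cL => p; apply: le_trans; apply: ge0_le_integral => //.
- by move=> y _; rewrite lee_fin; exact: f0.
- exact: mf.
- exact/measurable_EFinP.
- by move=> y _; rewrite lee_fin; exact: lower_env_le.
Qed.

End Multicouplings.

(** * Approximate gluing *)

Section Gluing.
Context {R : realType}.

Lemma measure_fibers d (T : measurableType d) (m : {measure set T -> \bar R})
    (q : T -> nat) (A : set T) : measurable_fun setT q -> measurable A ->
  m A = \sum_(k <oo) m (A `&` q @^-1` [set k]).
Proof.
move=> mq mA; have mqk k : measurable (q @^-1` [set k]).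
  by have := mq measurableT [set k] I; rewrite setTI.
rewrite -[LHS](_ : m (\bigcup_k (A `&` q @^-1` [set k])) = _).
  rewrite measure_bigcup //; first by apply: eq_eseriesl => k; rewrite in_setT.
    by move=> k _; exact: measurableI.
  by apply/trivIsetP => i j _ _ /eqP ij; apply/seteqP; split=> x //= -[[_ xi] [_ xj]]; case: ij; rewrite -xi -xj.
by congr (m _); apply/seteqP; split=> [x [k _ []]//|x Ax]; exists (q x).
Qed.

Lemma measurable_nat_neq d (T : measurableType d) (f g : T -> nat) :
  measurable_fun setT f -> measurable_fun setT g -> measurable [set x | f x <> g x].
Proof.
move=> mf mg; have := measurableC (measurable_event (measurable_fun_eqn mf mg)).
by congr measurable; apply/seteqP; split=> x /= fg => [/eqP|/eqP].
Qed.

Section TwoSpaces.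
Context d1 (T1 : measurableType d1) d2 (T2 : measurableType d2).
Variables (P1 : probability T1 R) (P2 : probability T2 R).
Variables (q1 : T1 -> nat) (q2 : T2 -> nat).
Hypotheses (mq1 : measurable_fun setT q1) (mq2 : measurable_fun setT q2).
Hypothesis q12 : forall k, P1 (q1 @^-1` [set k]) = P2 (q2 @^-1` [set k]).

Let mq1k k : measurable (q1 @^-1` [set k]).
Proof. by rewrite -[X in measurable X]setTI; exact: mq1. Qed.

Let mq2k k : measurable (q2 @^-1` [set k]).
Proof. by rewrite -[X in measurable X]setTI; exact: mq2. Qed.

Let rect k : set (T1 * T2) := (q1 @^-1` [set k]) `*` (q2 @^-1` [set k]).

Let mrect k : measurable (rect k).
Proof. exact: measurableX. Qed.

Let inv_mass k : {nonneg R} := (`|(fine (P1 (q1 @^-1` [set k])))^-1|)%:nng%R.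

Let glue_measure := mseries
  (fun k => mscale (inv_mass k) (mrestr (P1 \x P2) (mrect k))) 0.

Let cancel_mass k x : 0 <= x -> x <= P1 (q1 @^-1` [set k]) ->
  (inv_mass k)%:num%:E * (x * P1 (q1 @^-1` [set k])) = x.
Proof.
move=> x0 xle; have wfin : P1 (q1 @^-1` [set k]) \is a fin_num by rewrite fin_num_measure.
have [w0|w0] := eqVneq (P1 (q1 @^-1` [set k])) 0.
  by rewrite w0 mule0 mule0; apply/eqP; rewrite eq_le x0 -w0 xle.
rewrite /= ger0_norm ?invr_ge0 ?fine_ge0 // -[in X in _ * (_ * X)](fineK wfin).
by rewrite muleCA -EFinM mulVf ?mule1 // fine_eq0.
Qed.

(** Conditionally on the common value of [q1] and [q2] the two coordinates are
    independent. On cells of mass 0 the inverse mass is 0 as well, and nothing is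
    lost. *)
Lemma glue_two : exists G : probability (T1 * T2)%type R,
  [/\ forall A, measurable A -> G (fst @^-1` A) = P1 A,
      forall B, measurable B -> G (snd @^-1` B) = P2 B
    & G [set z | q1 z.1 <> q2 z.2] = 0].
Proof.
have gl1 A : measurable A -> glue_measure (fst @^-1` A) = P1 A.
  move=> mA; rewrite (measure_fibers P1 mq1 mA) /glue_measure /mseries.
  apply: eq_eseriesr => k _.
  transitivity ((inv_mass k)%:num%:E * (P1 \x P2) (fst @^-1` A `&` rect k)); first by [].
  have -> : fst @^-1` A `&` rect k = (A `&` q1 @^-1` [set k]) `*` (q2 @^-1` [set k]).
    by apply/seteqP; split=> z /=; rewrite /rect /=; tauto.
  transitivity ((inv_mass k)%:num%:E * (P1 (A `&` q1 @^-1` [set k]) * P1 (q1 @^-1` [set k]))).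
    congr (_ * _); apply: etrans (product_measure1E _ _ _ _) _ => //; first exact: measurableI.
    by congr (_ * _); exact/esym/q12.
  rewrite cancel_mass //.
  by apply: le_measure; rewrite ?inE //; exact: measurableI.
have gl2 B : measurable B -> glue_measure (snd @^-1` B) = P2 B.
  move=> mB; rewrite (measure_fibers P2 mq2 mB) /glue_measure /mseries.
  apply: eq_eseriesr => k _.
  transitivity ((inv_mass k)%:num%:E * (P1 \x P2) (snd @^-1` B `&` rect k)); first by [].
  have -> : snd @^-1` B `&` rect k = (q1 @^-1` [set k]) `*` (B `&` q2 @^-1` [set k]).
    by apply/seteqP; split=> z /=; rewrite /rect /=; tauto.
  transitivity ((inv_mass k)%:num%:E * (P2 (B `&` q2 @^-1` [set k]) * P1 (q1 @^-1` [set k]))).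
    congr (_ * _); apply: etrans (product_measure1E _ _ _ _) _ => //; first exact: measurableI.
    exact: muleC.
  rewrite cancel_mass // q12.
  by apply: le_measure; rewrite ?inE //; exact: measurableI.
have [|G GE] := @probability_of_measure R _ _ glue_measure.
  by have := gl1 setT measurableT; rewrite preimage_setT probability_setT.
exists G; split=> [A mA|B mB|]; rewrite GE; [exact: gl1|exact: gl2|].
transitivity (\sum_(k <oo) (inv_mass k)%:num%:E *
    (P1 \x P2) ([set z | q1 z.1 <> q2 z.2] `&` rect k)); first by [].
rewrite eseries0 // => k _ _; rewrite (_ : _ `&` _ = set0) ?measure0 ?mule0 //.
by apply/seteqP; split=> z //= -[qz [/= z1 z2]]; apply: qz; rewrite z1 z2.
Qed.

End TwoSpaces.

(** Each step enlarges the probability space by one factor, keeping the variables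
    already built. *)
Lemma glue_family (J : eqType) d0 (T0 : measurableType d0) (P0 : probability T0 R)
    d (T : measurableType d) (eta : J -> probability T R)
    (q : J -> T0 -> nat) (r : J -> T -> nat) :
  (forall i, measurable_fun setT (q i)) -> (forall i, measurable_fun setT (r i)) ->
  (forall i k, P0 (q i @^-1` [set k]) = eta i (r i @^-1` [set k])) ->
  forall s : seq J, exists d' (W : measurableType d') (P : probability W R)
    (X : W -> T0) (Z : J -> W -> T),
    [/\ measurable_fun setT X, forall i, measurable_fun setT (Z i),
        forall A, measurable A -> P (X @^-1` A) = P0 A
      & forall i, i \in s -> (forall A, measurable A -> P (Z i @^-1` A) = eta i A) /\
          P [set x | q i (X x) <> r i (Z i x)] = 0].
Proof.
move=> mq mr qr; elim=> [|i0 s [d' [W [P [X [Z [mX mZ PX PZ]]]]]]].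
  by exists d0, T0, P0, id, (fun _ _ => point); split.
have mqX : measurable_fun setT (q i0 \o X) by exact: measurableT_comp.
have [|G [G1 G2 Gne]] := @glue_two _ W _ T P (eta i0) _ _ mqX (mr i0).
  move=> k; rewrite -qr -PX //.
  by have := mq i0 measurableT [set k] I; rewrite setTI.
exists _, (W * T)%type, G, (X \o fst), (fun i => if i == i0 then snd else Z i \o fst).
split.
- exact: measurableT_comp.
- by move=> i; case: eqP => // _; exact: measurableT_comp.
- move=> A mA; rewrite -PX // -[RHS]G1 //.
  by have := mX measurableT A mA; rewrite setTI.
move=> i; rewrite inE; case: eqP => [->|_] /= is_; first by split.
have [PZi PZ0] := PZ i is_; split=> [A mA|].
  rewrite -PZi // -[RHS]G1 //.
  by have := mZ i measurableT A mA; rewrite setTI.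
rewrite -PZ0 -[RHS]G1 //.
apply: measurable_nat_neq.
  exact: measurableT_comp (mq i) mX.
exact: measurableT_comp (mr i) (mZ i).
Qed.

End Gluing.

(** * Euclidean norm *)

Section EuclideanNorm.
Context {R : realType}.

Lemma enorm_sqE m n (x : 'M[R]_(m, n)) :
  (enorm x ^+ 2 = \sum_(i < m) \sum_(j < n) x i j ^+ 2)%R.
Proof.
by rewrite sqr_sqrtr //; apply: sumr_ge0 => i _; apply: sumr_ge0 => j _; exact: sqr_ge0.
Qed.

Lemma enorm_row_sqE n (x : 'rV[R]_n) : (enorm x ^+ 2 = \sum_(j < n) x ord0 j ^+ 2)%R.
Proof. by rewrite enorm_sqE big_ord1. Qed.

Lemma measurable_enorm_sq k d : measurable_fun setT (fun x : Rpow R k d => (enorm x ^+ 2)%R).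
Proof.
under eq_fun do rewrite enorm_sqE.
apply: measurable_sum => i; apply: measurable_sum => j.
by apply: measurable_funX; exact: measurable_coord.
Qed.

Lemma ler_entry_enorm m n (x : 'M[R]_(m, n)) i j : (`|x i j| <= enorm x)%R.
Proof.
rewrite -(ler_pXn2r (n := 2)) ?nnegrE // ?sqrtr_ge0 // enorm_sqE real_normK ?num_real //.
rewrite (bigD1 i) //= (bigD1 j) //= -addrA lerDl addr_ge0 //.
  by apply: sumr_ge0 => *; exact: sqr_ge0.
by apply: sumr_ge0 => *; apply: sumr_ge0 => *; exact: sqr_ge0.
Qed.

Lemma enorm_mulmx m n p (A : 'M[R]_(m, n)) : exists2 K : R, (0 <= K)%R &
  forall x : 'M[R]_(n, p), (enorm (A *m x) ^+ 2 <= K * enorm x ^+ 2)%R.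
Proof.
exists (\sum_(i < m) \sum_(j < p) (\sum_k `|A i k|) ^+ 2)%R.
  by apply: sumr_ge0 => i _; apply: sumr_ge0 => j _; exact: sqr_ge0.
move=> x; rewrite enorm_sqE mulr_suml; apply: ler_sum => i _.
rewrite mulr_suml; apply: ler_sum => j _.
rewrite -exprMn -[leLHS]real_normK ?num_real //.
rewrite ler_pXn2r ?nnegrE ?normr_ge0 ?mulr_ge0 ?sqrtr_ge0 ?sumr_ge0 //.
rewrite mxE (le_trans (ler_norm_sum _ _ _)) // mulr_suml; apply: ler_sum => k _.
by rewrite normrM ler_wpM2l ?ler_entry_enorm.
Qed.

(** Young's inequality: the weight of the first term may be taken as close to 1
    as desired, at the price of a large weight on the second. *)
Lemma enorm_sq_relaxed_triangle n (x y z : 'rV[R]_n) (s : R) : (0 < s)%R ->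
  (enorm (x - z) ^+ 2 <= (1 + s) * enorm (y - z) ^+ 2 + (1 + s^-1) * enorm (x - y) ^+ 2)%R.
Proof.
move=> s0; rewrite !enorm_row_sqE !mulr_sumr -big_split /=; apply: ler_sum => j _.
rewrite !mxE; set a := (y _ j - z _ j)%R; set b := (x _ j - y _ j)%R.
have -> : (x ord0 j - z ord0 j = a + b)%R by rewrite /a /b; ring.
have -> : ((1 + s) * a ^+ 2 + (1 + s^-1) * b ^+ 2 =
           (a + b) ^+ 2 + s^-1 * (s * a - b) ^+ 2)%R.
  by field; rewrite gt_eqF.
by rewrite lerDl mulr_ge0 ?invr_ge0 ?sqr_ge0 // ltW.
Qed.

Lemma measurable_fun_nat d (T : measurableType d) (q : T -> nat) :
  (forall k, measurable (q @^-1` [set k])) -> measurable_fun setT q.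
Proof.
move=> mq _ Y _; rewrite setTI (_ : q @^-1` Y = \bigcup_(k in Y) (q @^-1` [set k])).
  exact: bigcup_measurable.
by apply/seteqP; split=> x /= => [Yq|[k Yk xk]]; [exists (q x)|rewrite xk].
Qed.

(** Cubes of side [h] with [n h^2 <= e], indexed by the integer vectors of their
    corners. *)
Lemma small_cells n (e : R) : (0 < e)%R -> exists q : Rpow R 1 n -> nat,
  measurable_fun setT q /\ forall x y, q x = q y -> (enorm (x - y) ^+ 2 <= e)%R.
Proof.
move=> e0; pose h : R := Num.sqrt (e / n.+1%:R).
have h0 : (0 < h)%R by rewrite sqrtr_gt0 divr_gt0.
pose v (x : Rpow R 1 n) : 'rV[int]_n := \row_j Num.floor (x ord0 j / h).
exists (fun x => pickle (v x)); split.
  apply: measurable_fun_nat => k.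
  case E : (unpickle k : option 'rV[int]_n) => [u|]; last first.
    rewrite (_ : _ @^-1` _ = set0) //; apply/seteqP; split=> x //= xk.
    by move: E; rewrite -xk pickleK.
  rewrite (_ : _ @^-1` _ = if pickle u == k then \bigcap_(j : 'I_n)
      ((fun x : Rpow R 1 n => x ord0 j) @^-1` `[((u ord0 j)%:~R * h)%R, ((u ord0 j + 1)%:~R * h)%R[) else set0).
    case: ifP => // _; apply: fin_bigcap_measurable => // j _.
    by rewrite -[X in measurable X]setTI; exact: measurable_coord.
  apply/seteqP; split=> x /=.
    move=> xk; move: E; rewrite -xk pickleK => -[<-]; rewrite eqxx => j _ /=.
    by rewrite in_itv /= mxE -ler_pdivlMr // -ltr_pdivrMr // floor_le_tmp floorD1_gt.
  case: eqP => // uk xu; rewrite -uk; congr pickle; apply/rowP => j; rewrite mxE.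
  have := xu j I; rewrite /= in_itv /= -ler_pdivlMr // -ltr_pdivrMr // => xj.
  exact: floor_def.
move=> x y /(pcan_inj pickleK)/rowP vxy.
have hh : (n%:R * h ^+ 2 <= e)%R.
  rewrite sqr_sqrtr ?divr_ge0 ?(ltW e0) // mulrCA ler_piMr ?(ltW e0) //.
  by rewrite ler_pdivrMr // mul1r ler_nat.
apply: le_trans hh; rewrite enorm_row_sqE -[n in n%:R]card_ord -sum1_card natr_sum mulr_suml.
apply: ler_sum => j _; rewrite mul1r !mxE -real_normK ?num_real // ler_pXn2r ?nnegrE ?(ltW h0) //.
have := vxy j; rewrite !mxE => fxy.
rewrite -[leRHS]mulr1 -ler_pdivrMl // mulrC.
rewrite -[X in (_ * X)%R](@gtr0_norm _ h^-1) ?invr_gt0 // -normrM mulrBl ler_norml.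
have := floorD1_gt (x ord0 j / h); have := floor_le_tmp (x ord0 j / h).
have := floorD1_gt (y ord0 j / h); have := floor_le_tmp (y ord0 j / h).
rewrite -fxy rmorphD /= => *; apply/andP; split; lra.
Qed.

End EuclideanNorm.

(** * Least squares regression of the positions on the times *)

Section Regression.
Context {R : realType} (N : nat) (t : 'I_N -> R).

Definition mean_time : R := (N%:R^-1 * \sum_i t i)%R.
Definition time_scatter : R := (\sum_i (t i - mean_time) ^+ 2)%R.

(** Row [a] gives the value at time [a] (0 or 1) of the regression line of [y]
    on the times, as a linear function of [y]. If all times coincide then
    [time_scatter] is 0, its inverse is 0 by convention, and the line is
    constant equal to the mean of [y], which is again optimal. *)
Definition ols_weights : 'M[R]_(2, N) :=
  \matrix_(a, i) (N%:R^-1 + (a%:R - mean_time) * (t i - mean_time) / time_scatter)%R.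

Lemma sum_centered : (0 < N)%N -> (\sum_i (t i - mean_time) = 0)%R.
Proof.
move=> N0; rewrite big_split /= sumrN sumr_const card_ord -mulr_natl /mean_time.
by rewrite mulrA divff ?mul1r ?subrr // pnatr_eq0 -lt0n.
Qed.

(** With centered times and values, the cost of a line of slope [c] minus that of
    the regression line of slope [be] is
    [N k^2 + (c - be)^2 time_scatter], where [k] is the error at the mean time. *)
Lemma ols_optimal (y : 'I_N -> R) (a b : R) : (0 < N)%N ->
  (\sum_i (((1 - t i) * (\sum_j ols_weights 0 j * y j)
            + t i * (\sum_j ols_weights 1 j * y j)) - y i) ^+ 2
   <= \sum_i (((1 - t i) * a + t i * b) - y i) ^+ 2)%R.
Proof.
move=> N0; have su := sum_centered N0.
pose u i := (t i - mean_time)%R; pose ybar := (N%:R^-1 * \sum_i y i)%R.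
pose v i := (y i - ybar)%R; pose W := (\sum_i u i * y i)%R; pose be := (W / time_scatter)%R.
have N1 : (N%:R != 0 :> R)%R by rewrite pnatr_eq0 -lt0n.
have sv : (\sum_i v i = 0)%R.
  rewrite big_split /= sumrN sumr_const card_ord -mulr_natl /ybar.
  by rewrite mulrA divff ?mul1r ?subrr.
have uv : (\sum_i u i * v i = be * time_scatter)%R.
  have -> : (\sum_i u i * v i = W)%R.
    rewrite /v; under eq_bigr do rewrite mulrBr.
    by rewrite big_split /= sumrN -mulr_suml su mul0r subr0.
  have [U0|U0] := eqVneq time_scatter 0%R; last by rewrite /be mulfVK.
  rewrite U0 mulr0 /W big1 // => i _; suff -> : u i = 0%R by rewrite mul0r.
  apply/eqP; rewrite -sqrf_eq0; apply/eqP.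
  by move/eqP: U0; rewrite psumr_eq0 => [/allP/(_ i)|*]; [rewrite mem_index_enum => /(_ isT)/eqP|exact: sqr_ge0].
have wE (c : 'I_2) : (\sum_j ols_weights c j * y j = ybar + (c%:R - mean_time) * be)%R.
  rewrite /ybar /be /W mulr_sumr mulr_suml mulr_sumr -big_split /=.
  by apply: eq_bigr => j _; rewrite mxE /u; ring.
rewrite !wE /= modn_small //.
have sumsq (k be' : R) : (\sum_i (k + (be' * u i - v i)) ^+ 2 =
    N%:R * k ^+ 2 + be' ^+ 2 * time_scatter - 2 * be' * (be * time_scatter) + \sum_i v i ^+ 2)%R.
  transitivity (\sum_i (k ^+ 2 + be' ^+ 2 * u i ^+ 2 - 2 * be' * (u i * v i) + v i ^+ 2
     + (2 * k * be' * u i - 2 * k * v i)))%R.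
    by apply: eq_bigr => i _; ring.
  rewrite !big_split /= sumr_const card_ord !sumrN -!mulr_sumr su sv uv -mulr_natl -/time_scatter.
  by ring.
rewrite (eq_bigr (fun i => (0 + (be * u i - v i)) ^+ 2)%R); last first.
  by move=> i _; rewrite /u /v; congr (_ ^+ 2)%R; ring.
rewrite [leRHS](eq_bigr (fun i => ((a + (b - a) * mean_time - ybar) + ((b - a) * u i - v i)) ^+ 2)%R); last first.
  by move=> i _; rewrite /u /v; congr (_ ^+ 2)%R; ring.
rewrite !sumsq -subr_ge0.
set k := (_ - ybar)%R; set c := (b - a)%R.
have -> : (N%:R * k ^+ 2 + c ^+ 2 * time_scatter - 2 * c * (be * time_scatter) + \sum_i v i ^+ 2 -
   (N%:R * 0 ^+ 2 + be ^+ 2 * time_scatter - 2 * be * (be * time_scatter) + \sum_i v i ^+ 2) =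
   N%:R * k ^+ 2 + (c - be) ^+ 2 * time_scatter)%R by ring.
have var0 : (0 <= time_scatter)%R by apply: sumr_ge0 => i _; exact: sqr_ge0.
by apply: addr_ge0; apply: mulr_ge0; rewrite ?sqr_ge0 ?ler0n.
Qed.

End Regression.

Section Residual.
Context {R : realType} (d N : nat) (t : 'I_N -> R).

(** The cost of the best-fitting pair (x_0, x_1) as a function of the targets. *)
Definition residual (y : Rpow R N d) : R :=
  (\sum_(i < N) N%:R^-1 * enorm (interp (t i) (ols_weights t *m y) - row i y) ^+ 2)%R.

Lemma residual_ge0 y : (0 <= residual y)%R.
Proof. by apply: sumr_ge0 => i _; rewrite mulr_ge0 ?sqr_ge0 ?invr_ge0. Qed.

Lemma residual_le (x : Rpow R 2 d) (y : Rpow R N d) : (0 < N)%N ->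
  (residual y <= \sum_(i < N) N%:R^-1 * enorm (interp (t i) x - row i y) ^+ 2)%R.
Proof.
move=> N0; rewrite /residual -!mulr_sumr ler_wpM2l ?invr_ge0 //.
under eq_bigr do rewrite enorm_row_sqE.
under [leRHS]eq_bigr do rewrite enorm_row_sqE.
rewrite exchange_big [leRHS]exchange_big /=; apply: ler_sum => c _.
under eq_bigr do rewrite /interp !mxE.
under [leRHS]eq_bigr do rewrite /interp !mxE.
exact: (@ols_optimal _ _ t (fun i => y i c)).
Qed.

Lemma continuous_residual : continuous (residual : 'M[R]_(N, d) -> R).
Proof.
have cadd (V : topologicalType) (f g : V -> R) : continuous f -> continuous g ->
    continuous (fun v => f v + g v)%R.
  by move=> cf cg v; apply: continuousD; [exact: cf|exact: cg].
have cmul (V : topologicalType) (f g : V -> R) : continuous f -> continuous g ->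
    continuous (fun v => f v * g v)%R.
  by move=> cf cg v; apply: continuousM; [exact: cf|exact: cg].
have csum (V : topologicalType) (I : Type) (r : seq I) (f : I -> V -> R) :
    (forall i, continuous (f i)) -> continuous (fun v => \sum_(i <- r) f i v)%R.
  by move=> cf; apply: (@continuous_big _ _ _ _ xpredT) => // ; exact: add_continuous.
have ccoord i c : continuous (fun y : 'M[R]_(N, d) => y i c) by exact: coord_continuous.
have cscale (V : topologicalType) a (f : V -> R) : continuous f ->
    continuous (fun v => a * f v)%R.
  by move=> cf; apply: cmul => // v; exact: cst_continuous.
have cfit (a : 'I_2) c : continuous (fun y : 'M[R]_(N, d) => (ols_weights t *m y) a c).
  under eq_fun do rewrite mxE.
  by apply: csum => k; apply: cscale.
have centry i c : continuous (fun y : 'M[R]_(N, d) =>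
    (interp (t i) (ols_weights t *m y) - row i y)%R ord0 c).
  rewrite (_ : (fun y => _) = (fun y => ((1 - t i) * (ols_weights t *m y) ord0 c +
      t i * (ols_weights t *m y) 1 c) + -1 * y i c)%R).
    have c01 : continuous (fun y : 'M[R]_(N, d) =>
        (1 - t i) * (ols_weights t *m y) ord0 c + t i * (ols_weights t *m y) 1 c)%R.
      exact: (cadd _ _ _ (cscale _ _ _ (cfit _ _)) (cscale _ _ _ (cfit _ _))).
    exact: (cadd _ _ _ c01 (cscale _ _ _ (ccoord _ _))).
  by apply/funext => y; rewrite /interp !mxE mulN1r.
apply: (@csum _) => i; apply: (@cscale _).
under eq_fun do rewrite enorm_row_sqE.
by apply: csum => c; apply: cmul; exact: centry.
Qed.

End Residual.

(** * Laws and costs of joint constructions *)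

Section Costs.
Context {R : realType}.

Lemma integral_law d (T : measurableType d) (P : probability T R)
    d' (T' : measurableType d') (m : {measure set T' -> \bar R}) (Y : T -> T')
    (g : T' -> R) :
  measurable_fun setT Y -> (forall A, measurable A -> P (Y @^-1` A) = m A) ->
  measurable_fun setT g -> (forall y, 0 <= g y)%R ->
  \int[P]_x (g (Y x))%:E = \int[m]_y (g y)%:E.
Proof.
move=> mY PY mg g0.
rewrite [RHS](eq_measure_integral (pushforward P Y)).
  rewrite ge0_integral_pushforward //; first by apply/measurable_EFinP.
  by move=> y _; rewrite lee_fin.
by move=> A mA _; rewrite -PY.
Qed.

Lemma law_of d (T : measurableType d) (P : probability T R)
    d' (T' : measurableType d') (Y : T -> T') : measurable_fun setT Y ->
  exists Q : probability T' R, forall A, Q A = P (Y @^-1` A).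
Proof.
move=> mY; pose Y' : {mfun T >-> T'} := HB.pack Y (isMeasurableFun.Build _ _ _ _ _ mY).
by exists (distribution P Y').
Qed.

Lemma measurable_enorm_sqB d k n (T : measurableType d) (f g : T -> Rpow R k n) :
  measurable_fun setT f -> measurable_fun setT g ->
  measurable_fun setT (fun x => enorm (f x - g x) ^+ 2)%R.
Proof.
move=> mf mg.
apply: (measurableT_comp (@measurable_enorm_sq R k n)).
apply: measurable_fun_Rpow => i j; under eq_fun do rewrite !mxE.
by apply: measurable_funB; apply: measurableT_comp (measurable_coord _ _) _.
Qed.

Section Joint.
Variables (d N : nat).
Context d' (T : measurableType d') (P : probability T R).
Variables (X : T -> Rpow R 2 d) (Y : 'I_N -> T -> Rpow R 1 d).
Hypotheses (mX : measurable_fun setT X) (mY : forall i, measurable_fun setT (Y i)).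

Definition stack (x : T) : Rpow R (2 + N) d :=
  col_mx (X x) (\matrix_(i < N, c < d) Y i x 0%R c).

Lemma measurable_stack : measurable_fun setT stack.
Proof.
apply: measurable_fun_Rpow => i j; rewrite /stack; under eq_fun do rewrite mxE.
case: (splitP i) => k _.
  exact: measurableT_comp (measurable_coord _ _) mX.
under eq_fun do rewrite mxE.
exact: measurableT_comp (measurable_coord _ _) (mY k).
Qed.

Lemma first2_stack x : first2 (stack x) = X x.
Proof. exact: col_mxKu. Qed.

Lemma component_stack i x : component (rshift 2 i) (stack x) = Y i x.
Proof.
by apply/rowP => c; rewrite /component mxE /stack col_mxEd mxE.
Qed.

Lemma enorm_sq_stack x :
  (enorm (stack x) ^+ 2 = enorm (X x) ^+ 2 + \sum_(i < N) enorm (Y i x) ^+ 2)%R.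
Proof.
rewrite !enorm_sqE big_split_ord /=; congr (_ + _)%R.
  by apply: eq_bigr => i _; apply: eq_bigr => j _; rewrite /stack col_mxEu.
apply: eq_bigr => i _; rewrite enorm_row_sqE; apply: eq_bigr => j _.
by rewrite /stack col_mxEd mxE.
Qed.

Lemma stack_feasible (t : 'I_N -> R) (mu : 'I_N -> probability (Rpow R 1 d) R) :
  (forall i, P2 (mu i)) ->
  (forall i A, measurable A -> P (Y i @^-1` A) = mu i A) ->
  \int[P]_x (enorm (X x) ^+ 2)%:E < +oo ->
  exists2 g, feasible mu g & G_obj t g =
    \int[P]_x (\sum_(i < N) N%:R^-1 * enorm (interp (t i) (X x) - Y i x) ^+ 2)%R%:E.
Proof.
move=> hmu PY X2; have [g gE] := law_of P measurable_stack.
have gP A : measurable A -> P (stack @^-1` A) = g A by rewrite gE.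
exists g; last first.
  rewrite /G_obj -(integral_law measurable_stack gP (g := fun z : Rpow R (2 + N) d =>
    (\sum_(i < N) N%:R^-1 * enorm (interp (t i) (first2 z) - component (rshift 2 i) z) ^+ 2)%R)).
  - apply: eq_integral => x _; congr _%:E; apply: eq_bigr => i _.
    by rewrite first2_stack component_stack.
  - apply: measurable_sum => i; apply: measurable_funM => //.
    apply: measurable_enorm_sqB; last exact: measurable_component.
    exact: measurableT_comp (@measurable_interp _ _ _) (@measurable_first2 _ _ _).
  - by move=> y; apply: sumr_ge0 => i _; rewrite mulr_ge0 ?sqr_ge0 ?invr_ge0.
split=> [|i A mA].
  rewrite /P2 /= -(integral_law measurable_stack gP
    (g := fun z : Rpow R (2 + N) d => (enorm z ^+ 2)%R)); last 2 first.
  - exact: measurable_enorm_sq.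
  - by move=> y; exact: sqr_ge0.
  under eq_integral do rewrite enorm_sq_stack EFinD -sumEFin.
  have mE k (f : T -> Rpow R k d) : measurable_fun setT f ->
      measurable_fun setT (fun x => (enorm (f x) ^+ 2)%:E : \bar R).
    by move=> mf; apply/measurable_EFinP; exact: measurableT_comp (@measurable_enorm_sq _ _ _) mf.
  rewrite ge0_integralD //; first last.
  - by apply: emeasurable_sum => i; exact: mE.
  - by move=> x _; apply: sume_ge0 => i _; rewrite lee_fin sqr_ge0.
  - exact: mE.
  - by move=> x _; rewrite lee_fin sqr_ge0.
  rewrite lte_add_pinfty // ge0_integral_sum //; first last.
  - by move=> i x _; rewrite lee_fin sqr_ge0.
  - by move=> i; exact: mE.
  apply: lte_sum_pinfty => i _.
  rewrite (integral_law (mY i) (PY i) (g := fun z : Rpow R 1 d => (enorm z ^+ 2)%R)); [exact: hmu| |].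
  - exact: measurable_enorm_sq.
  - by move=> y; exact: sqr_ge0.
rewrite -PY //; apply: etrans (gE _) _; congr (P _); apply/funext => x.
by rewrite /pushforward /preimage /mkset /= component_stack.
Qed.

End Joint.

(** With [s] so small that [s] times the cost of [eta] is at most [e / 2], choose
    [dlt] so that the remaining error term is also [e / 2]. *)
Lemma glued_cost d (eta : probability (Rpow R 2 d) R) (e : R) : (0 < e)%R ->
  transport_cost eta < +oo ->
  exists dlt : R, (0 < dlt)%R /\
    forall d' (T : measurableType d') (P : probability T R) (f : T -> Rpow R 1 d)
      (Z : T -> Rpow R 2 d),
    measurable_fun setT f -> measurable_fun setT Z ->
    (forall A, measurable A -> P (Z @^-1` A) = eta A) ->
    {ae P, forall x, enorm (f x - component 0%R (Z x)) ^+ 2 <= dlt}%R ->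
    \int[P]_x (enorm (f x - component 1%R (Z x)) ^+ 2)%:E <= transport_cost eta + e%:E.
Proof.
move=> e0 cfin.
have c0 : 0 <= transport_cost eta by apply: integral_ge0 => z _; rewrite lee_fin sqr_ge0.
have cf : transport_cost eta \is a fin_num by rewrite ge0_fin_numE.
pose c := fine (transport_cost eta); have cE : transport_cost eta = c%:E by rewrite fineK.
have c0' : (0 <= c)%R by rewrite -lee_fin -cE.
pose s := (e / 2 / (c + 1))%R; have s0 : (0 < s)%R by rewrite !divr_gt0 // ltr_wpDl.
pose dlt := (e / 2 / (1 + s^-1))%R.
have s1 : (0 < 1 + s^-1)%R by rewrite ltr_wpDl // invr_gt0.
have d0 : (0 < dlt)%R by rewrite !divr_gt0.
have s2 : (0 <= 1 + s)%R by rewrite addr_ge0 // ltW.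
have err0 : (0 <= (1 + s^-1) * dlt)%R by rewrite mulr_ge0 // ltW.
exists dlt; split=> // d' T P f Z mf mZ PZ fZ.
have mcost : measurable_fun setT (fun z : Rpow R 2 d => enorm (component 0 z - component 1 z) ^+ 2)%R.
  by apply: measurable_enorm_sqB; exact: measurable_component.
have m1 : measurable_fun setT (fun x => component 1%R (Z x)).
  exact: measurableT_comp (measurable_component _) mZ.
apply: (@le_trans _ _ (\int[P]_x ((1 + s) * enorm (component 0 (Z x) - component 1 (Z x)) ^+ 2
                         + (1 + s^-1) * dlt)%R%:E)).
  apply: ae_ge0_le_integral => //.
  - by move=> x _; rewrite lee_fin sqr_ge0.
  - by apply/measurable_EFinP; exact: measurable_enorm_sqB.
  - by move=> x _; rewrite lee_fin addr_ge0 // mulr_ge0 // sqr_ge0.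
  - apply/measurable_EFinP; apply: measurable_funD => //; apply: measurable_funM => //.
    exact: measurableT_comp mcost mZ.
  apply: filterS fZ => x fZx _; rewrite lee_fin.
  apply: le_trans (enorm_sq_relaxed_triangle (f x) (component 0%R (Z x)) (component 1%R (Z x)) s0) _.
  by rewrite lerD2l ler_wpM2l // ltW.
under eq_integral do rewrite EFinD EFinM.
rewrite ge0_integralD //; first last.
- apply: measurable_funeM; apply/measurable_EFinP; exact: measurableT_comp mcost mZ.
- by move=> x _; rewrite mule_ge0 // lee_fin sqr_ge0.
rewrite integral_cst // [X in _ + _ * X]probability_setT mule1.
rewrite ge0_integralZl_EFin //; first last.
- by apply/measurable_EFinP; exact: measurableT_comp mcost mZ.
- by move=> x _; rewrite lee_fin sqr_ge0.
rewrite (integral_law mZ PZ mcost) => [|z]; last exact: sqr_ge0.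
rewrite -/(transport_cost eta) cE -EFinM -!EFinD lee_fin.
have -> : ((1 + s^-1) * dlt = e / 2)%R by rewrite /dlt mulrC divfK // gt_eqF.
have : (s * c <= e / 2)%R.
  rewrite /s mulrAC ler_pdivrMr ?ltr_wpDl // ler_wpM2l ?divr_ge0 ?(ltW e0) //.
  by rewrite lerDl.
by lra.
Qed.

End Costs.

(** * The two problems *)

Section Relaxation.
Context {R : realType} (d N : nat) (t : 'I_N -> R).
Variable mu : 'I_N -> probability (Rpow R 1 d) R.
Hypotheses (N0 : (0 < N)%N) (hmu : forall i, P2 (mu i)).

Lemma integral_average d' (T : measurableType d') (P : probability T R)
    (f : 'I_N -> T -> R) : (forall i, measurable_fun setT (f i)) ->
  (forall i x, 0 <= f i x)%R ->
  \int[P]_x (\sum_(i < N) N%:R^-1 * f i x)%R%:E =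
  \sum_(i < N) (N%:R^-1)%:E * \int[P]_x (f i x)%:E.
Proof.
move=> mf f0; under eq_integral do rewrite -sumEFin.
rewrite ge0_integral_sum //; first last.
- by move=> i x _; rewrite lee_fin mulr_ge0 ?invr_ge0.
- by move=> i; apply/measurable_EFinP; exact: measurable_funM.
apply: eq_bigr => i _; under eq_integral do rewrite EFinM.
rewrite ge0_integralZl_EFin ?invr_ge0 //; last exact/measurable_EFinP.
by move=> x _; rewrite lee_fin.
Qed.

Let leg i (z : Rpow R (2 + N) d) : Rpow R 2 d :=
  \matrix_(a < 2, c < d) (if a == 0 then interp (t i) (first2 z) 0 c
                          else component (rshift 2 i) z 0 c)%R.

Let leg0 i z : component 0%R (leg i z) = interp (t i) (first2 z).
Proof. by apply/rowP => c; rewrite /component !mxE. Qed.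

Let leg1 i z : component 1%R (leg i z) = component (rshift 2 i) z.
Proof. by apply/rowP => c; rewrite /component !mxE. Qed.

Let measurable_interp_first2 i :
  measurable_fun setT (fun z : Rpow R (2 + N) d => interp (t i) (first2 z)).
Proof. exact: measurableT_comp (@measurable_interp _ _ _) (@measurable_first2 _ _ _). Qed.

Let measurable_leg i : measurable_fun setT (leg i).
Proof.
apply: measurable_fun_Rpow => a c; rewrite /leg; under eq_fun do rewrite mxE.
case: (a == 0)%R.
  exact: measurableT_comp (measurable_coord _ _) (measurable_interp_first2 i).
exact: measurableT_comp (measurable_coord _ _) (@measurable_component _ _ _ _).
Qed.

(** The joint law of the interpolated point and of the i-th target is a coupling
    admissible for the i-th Wasserstein distance. *)
Lemma F_obj_le_G_obj (g : probability (Rpow R (2 + N) d) R) : feasible mu g ->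
  F_obj t mu (distribution g (@first2 R N d)) <= G_obj t g.
Proof.
move=> [_ gmu]; rewrite /G_obj integral_average; last 2 first.
- by move=> i; apply: measurable_enorm_sqB => //; exact: measurable_component.
- by move=> i x; exact: sqr_ge0.
apply: lee_sum => i _; rewrite lee_wpmul2l ?lee_fin ?invr_ge0 //.
have [eta etaE] := law_of g (measurable_leg i).
have getaE A : measurable A -> g (leg i @^-1` A) = eta A by rewrite etaE.
apply: ereal_inf_lbound; exists eta.
  split=> B mB.
    apply: etrans (etaE _) _; congr (g _); apply/funext => z.
    by rewrite /pushforward /preimage /mkset /= leg0.
  rewrite -(gmu i B mB); apply: etrans (etaE _) _; congr (g _); apply/funext => z.
  by rewrite /pushforward /preimage /mkset /= leg1.
rewrite /transport_cost -(integral_law (measurable_leg i) getaE (g := fun z : Rpow R 2 d =>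
  (enorm (component 0 z - component 1 z) ^+ 2)%R)).
- by apply: eq_integral => z _; rewrite leg0 leg1.
- by apply: measurable_enorm_sqB; exact: measurable_component.
- by move=> y; exact: sqr_ge0.
Qed.

Lemma P2_first2 (g : probability (Rpow R (2 + N) d) R) : P2 g ->
  P2 (distribution g (@first2 R N d)).
Proof.
rewrite /P2 /=; apply: le_lt_trans.
rewrite -(integral_law (@measurable_first2 R N d) (P := g) (g := fun z : Rpow R 2 d =>
  (enorm z ^+ 2)%R)) //; last 2 first.
- exact: measurable_enorm_sq.
- by move=> y; exact: sqr_ge0.
apply: ge0_le_integral => //.
- by move=> x _; rewrite lee_fin sqr_ge0.
- apply/measurable_EFinP.
  exact: measurableT_comp (@measurable_enorm_sq _ _ _) (@measurable_first2 _ _ _).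
- by apply/measurable_EFinP; exact: measurable_enorm_sq.
move=> z _; rewrite lee_fin !enorm_sqE [leRHS]big_split_ord /=.
rewrite -[leLHS]addr0 lerD //.
  by apply: ler_sum => i _; apply: ler_sum => j _; rewrite /first2 mxE.
by apply: sumr_ge0 => i _; apply: sumr_ge0 => j _; exact: sqr_ge0.
Qed.

(** Glue nearly optimal couplings along cells that are small enough for each of
    them. *)
Lemma G_obj_le_F_obj (pi : probability (Rpow R 2 d) R) (e : R) :
  P2 pi -> (0 < e)%R -> F_obj t mu pi < +oo ->
  exists2 g, feasible mu g & G_obj t g <= F_obj t mu pi + e%:E.
Proof.
move=> pi2 e0 Ffin.
have W0 i : 0 <= W2sq (distribution pi (interp (t i))) (mu i).
  apply: le_ereal_inf_tmp => _ [eta _ <-].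
  by apply: integral_ge0 => z _; rewrite lee_fin sqr_ge0.
have Ninv : (0 < N%:R^-1 :> R)%R by rewrite invr_gt0 ltr0n.
have Wfin i : W2sq (distribution pi (interp (t i))) (mu i) \is a fin_num.
  rewrite ge0_fin_numE // ltey; apply/eqP => Wy; move: Ffin.
  rewrite /F_obj (bigD1 i) //= Wy gt0_muley ?lte_fin // addye // gt_eqF //.
  rewrite (lt_le_trans (ltNyr 0%R)) //; apply: sume_ge0 => j _.
  by rewrite mule_ge0 // lee_fin ltW.
have e20 : (0 < e / 2)%R by rewrite divr_gt0.
have /choice[eta etaP] i : exists eta, couplings (distribution pi (interp (t i))) (mu i) eta /\
    transport_cost eta < W2sq (distribution pi (interp (t i))) (mu i) + (e / 2)%:E.
  by have [_ [eta ce <-] lt] := lb_ereal_inf_adherent e20 (Wfin i); exists eta.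
have costfin i : transport_cost (eta i) < +oo.
  by rewrite (lt_trans (etaP i).2) // -(fineK (Wfin i)) -EFinD ltry.
have /choice[dlt dltP] i := glued_cost e20 (costfin i).
have /choice[q qP] i := @small_cells R d _ (dltP i).1.
have mqi i : measurable_fun setT (q i \o interp (t i)).
  exact: measurableT_comp (qP i).1 (@measurable_interp _ _ _).
have mqc i : measurable_fun setT (q i \o @component R 2 d 0%R).
  exact: measurableT_comp (qP i).1 (@measurable_component _ _ _ _).
have mqk i k : measurable (q i @^-1` [set k]).
  by rewrite -[X in measurable X]setTI; exact: (qP i).1.
have qeta i k : pi ((q i \o interp (t i)) @^-1` [set k]) =
    eta i ((q i \o @component R 2 d 0%R) @^-1` [set k]).
  by have [[eta0 _] _] := etaP i; exact/esym/(eta0 _ (mqk i k)).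
have [d' [T [P [X [Z [mX mZ PX PZ]]]]]] :=
  @glue_family R 'I_N _ _ pi _ _ eta _ _ mqi mqc qeta (enum 'I_N).
have m1 i : measurable_fun setT (@component R 2 d 1%R \o Z i).
  exact: measurableT_comp (@measurable_component _ _ _ _) (mZ i).
have mi i : measurable_fun setT (interp (t i) \o X).
  exact: measurableT_comp (@measurable_interp _ _ _) mX.
have [||g gfeas gE] := @stack_feasible R d N _ T P X (fun i => @component R 2 d 1%R \o Z i)
  mX m1 t mu hmu.
- move=> i A mA; have [_ eta1] := (etaP i).1; rewrite -eta1 //.
  have [PZi _] := PZ i (mem_enum _ _).
  have mc1A : measurable (@component R 2 d 1%R @^-1` A).
    by rewrite -[X in measurable X]setTI; exact: measurable_component.
  exact: (PZi _ mc1A).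
- rewrite (integral_law mX PX (g := fun x : Rpow R 2 d => (enorm x ^+ 2)%R)) //.
    exact: measurable_enorm_sq.
  by move=> y; exact: sqr_ge0.
exists g => //; rewrite gE integral_average; last 2 first.
- by move=> i; exact: (measurable_enorm_sqB (mi i) (m1 i)).
- by move=> i x; exact: sqr_ge0.
have -> : e%:E = \sum_(i < N) (N%:R^-1)%:E * e%:E.
  rewrite sumEFin; congr _%:E; rewrite sumr_const card_ord -[RHS]mulr_natl mulrA divff ?mul1r //.
  by rewrite pnatr_eq0 -lt0n.
rewrite /F_obj -big_split /=; apply: lee_sum => i _.
rewrite -ge0_muleDr ?lee_fin ?(ltW e0) // lee_wpmul2l ?lee_fin ?(ltW Ninv) //.
have [PZi Pne] := PZ i (mem_enum _ _).
apply: le_trans ((dltP i).2 _ _ P _ _ (mi i) (mZ i) PZi _) _.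
  exists [set x | (q i \o interp (t i)) (X x) <> (q i \o component 0%R) (Z i x)]; split=> //.
    by apply: measurable_nat_neq; [exact: measurableT_comp mX|exact: measurableT_comp (mZ i)].
  by move=> x /= nle qx; apply: nle; exact: (qP i).2.
have := (etaP i).2; rewrite -(fineK (Wfin i)) => /ltW lt.
apply: le_trans (leeD2r _ lt) _; rewrite -!EFinD lee_fin; lra.
Qed.

Lemma feasible_nonempty : exists g, feasible mu g.
Proof.
have m0 d' (T : measurableType d') : measurable_fun setT (fun _ : T => 0%N) by [].
(* a single cell makes the factors independent *)
have [|d' [T [P [X [Z [mX mZ PX PZ]]]]]] := @glue_family R 'I_N _ (Rpow R 2 d) (\d_point) _ _ mu
  (fun _ _ => 0%N) (fun _ _ => 0%N) (fun=> m0 _ _) (fun=> m0 _ _) _ (enum 'I_N).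
  by move=> i k; rewrite !preimage_cst; case: ifP => _; rewrite ?measure0 ?probability_setT.
have [|||g gfeas _] := @stack_feasible R d N _ T P (fun=> 0%R) Z _ mZ t mu hmu.
- exact: measurable_cst.
- by move=> i A mA; have [+ _] := PZ i (mem_enum _ _); apply.
- rewrite (eq_integral (cst 0)) ?integral0 ?ltry // => x _.
  by rewrite enorm_sqE !big1 // => *; rewrite big1 // => *; rewrite mxE expr0n.
by exists g.
Qed.

Lemma G_obj_ge0 (g : probability (Rpow R (2 + N) d) R) : 0 <= G_obj t g.
Proof.
apply: integral_ge0 => z _; rewrite lee_fin; apply: sumr_ge0 => i _.
by rewrite mulr_ge0 ?sqr_ge0 ?invr_ge0.
Qed.

Lemma measurable_residual : measurable_fun setT (residual t : Rpow R N d -> R).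
Proof. by apply: measurable_continuous; exact: continuous_residual. Qed.

Let targets (z : Rpow R (2 + N) d) : Rpow R N d := dsubmx z.

Let measurable_targets : measurable_fun setT targets.
Proof.
apply: measurable_fun_Rpow => i c; rewrite /targets; under eq_fun do rewrite mxE.
exact: measurable_coord.
Qed.

(** Refitting (x_0, x_1) by least squares does not increase the cost. *)
Lemma residual_integral_le (g : probability (Rpow R (2 + N) d) R) :
  \int[g]_z (residual t (targets z))%:E <= G_obj t g.
Proof.
apply: ge0_le_integral => //.
- by move=> z _; rewrite lee_fin residual_ge0.
- apply/measurable_EFinP.
  exact: measurableT_comp measurable_residual measurable_targets.
- apply/measurable_EFinP; apply: measurable_sum => i; apply: measurable_funM => //.
  by apply: measurable_enorm_sqB => //; exact: measurable_component.
move=> z _; rewrite lee_fin.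
apply: le_trans (residual_le t (first2 z) _ N0) _.
rewrite le_eqVlt; apply/orP; left; apply/eqP; apply: eq_bigr => i _.
by congr (_ * enorm (_ - _) ^+ 2)%R; apply/rowP => c; rewrite /component !mxE.
Qed.

(** The laws of the targets along a minimizing sequence have a limit; completing
    it by the regression line gives a minimizer, whose second moment is finite
    because the fit is linear. *)
Lemma G_obj_has_minimizer : exists g, is_minimizer (feasible mu) (G_obj t) g.
Proof.
pose S := [set G_obj t g | g in feasible mu]; pose J := ereal_inf S.
have [g0 fg0] := feasible_nonempty.
have J0 : 0 <= J by apply: le_ereal_inf_tmp => _ [g _ <-]; exact: G_obj_ge0.
have Jlb g : feasible mu g -> J <= G_obj t g.
  by move=> fg; apply: ereal_inf_lbound; exists g.
have [Jfin|Jinf] := boolP (J \is a fin_num); last first.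
  have Jy : J = +oo by apply/eqP; move: Jinf; rewrite ge0_fin_numE // -leNgt leye_eq.
  exists g0; split=> // g fg; have := Jlb g fg; rewrite Jy leye_eq => /eqP ->.
  exact: leey.
suff [g fg gJ] : exists2 g, feasible mu g & G_obj t g <= J.
  by exists g; split=> // g' /Jlb; exact: le_trans.
have /choice[gam gamP] k : exists g, feasible mu g /\ G_obj t g < J + (k.+1%:R^-1)%:E.
  have k0 : (0 < k.+1%:R^-1 :> R)%R by rewrite invr_gt0.
  by have [_ [g fg <-] lt] := lb_ereal_inf_adherent k0 Jfin; exists g.
have mds := measurable_targets.
have /choice[Q QE] k := law_of (gam k) mds.
have QP k A : measurable A -> gam k (targets @^-1` A) = Q k A by rewrite QE.
have margQ k i : same_law (distribution (Q k) (component i)) (mu i).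
  move=> A mA; have [[_ gmu] _] := gamP k; rewrite -gmu //.
  apply: etrans (QE _ _) _; congr (gam k _); apply/funext => z.
  rewrite /pushforward /preimage /mkset /=; congr (A _).
  by apply/rowP => c; rewrite /component !mxE.
have [Gm [margG limG]] := multicoupling_limit margQ.
have mres := measurable_residual.
have resG : \int[Gm]_y (residual t y)%:E <= J.
  apply/lee_addgt0Pr => e e0; rewrite -(fineK Jfin) -EFinD.
  apply: limG; [exact: continuous_residual|exact: residual_ge0|].
  have [K _ Ke] : \forall k \near \oo, (k.+1%:R^-1 <= e)%R.
    by apply: filterS (near_infty_natSinv_lt (PosNum e0)) => k /ltW.
  exists K => // k /Ke /= ke.
  rewrite -(integral_law mds (QP k)) //; last exact: residual_ge0.
  apply: le_trans (residual_integral_le _) _.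
  have [_ /ltW lt] := gamP k; apply: le_trans lt _.
  by rewrite EFinD fineK // leeD2l // lee_fin.
have mfit : measurable_fun setT (mulmx (ols_weights t) : Rpow R N d -> Rpow R 2 d).
  apply: measurable_fun_Rpow => a c; under eq_fun do rewrite mxE.
  apply: measurable_sum => i; apply: measurable_funM => //.
  exact: measurable_coord.
have mcomp i := @measurable_component R N d i.
have [||g fg gE] := @stack_feasible R d N _ _ Gm (mulmx (ols_weights t)) (@component R N d)
  mfit mcomp t mu hmu.
- by move=> i A mA; exact: margG.
- have [K K0 KP] := enorm_mulmx d (ols_weights t).
  apply: (@le_lt_trans _ _ (K%:E * \sum_(i < N) \int[mu i]_x (enorm x ^+ 2)%:E)).
    have mrow i : measurable_fun setT (fun y : Rpow R N d => enorm (component i y) ^+ 2)%R.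
      exact: measurableT_comp (@measurable_enorm_sq _ _ _) (mcomp i).
    have -> : \sum_(i < N) \int[mu i]_x (enorm x ^+ 2)%:E =
        \int[Gm]_y (\sum_(i < N) enorm (component i y) ^+ 2)%R%:E.
      under [RHS]eq_integral do rewrite -sumEFin.
      rewrite ge0_integral_sum //; first last.
      - by move=> i y _; rewrite lee_fin sqr_ge0.
      - by move=> i; exact/measurable_EFinP.
      apply: eq_bigr => i _; apply/esym.
      apply: (integral_law (mcomp i) (margG i) (g := fun x : Rpow R 1 d => (enorm x ^+ 2)%R)).
        exact: measurable_enorm_sq.
      by move=> x; exact: sqr_ge0.
    have msum : measurable_fun setT (fun y : Rpow R N d => \sum_(i < N) enorm (component i y) ^+ 2)%R.
      exact: measurable_sum.
    have sum0 (y : Rpow R N d) : (0 <= \sum_(i < N) enorm (component i y) ^+ 2)%R.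
      by apply: sumr_ge0 => i _; exact: sqr_ge0.
    rewrite -ge0_integralZl_EFin //; first last.
    - exact/measurable_EFinP.
    - by move=> y _; rewrite lee_fin.
    apply: ge0_le_integral => //.
    - by move=> y _; rewrite lee_fin sqr_ge0.
    - by apply/measurable_EFinP; exact: measurableT_comp (@measurable_enorm_sq _ _ _) mfit.
    - by apply: measurable_funeM; exact/measurable_EFinP.
    move=> y _; rewrite -EFinM lee_fin; apply: le_trans (KP y) _.
    rewrite ler_wpM2l // enorm_sqE; apply: ler_sum => i _.
    by rewrite enorm_row_sqE; apply: ler_sum => c _; rewrite /component mxE.
  by rewrite lte_mul_pinfty ?lee_fin //; apply: lte_sum_pinfty => i _; exact: hmu.
by exists g => //; rewrite gE; exact: resG.
Qed.

End Relaxation.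

Theorem theorem4 (R : realType) (d N : nat) (hN : (0 < N)%N)
    (t : 'I_N -> R) (ht : forall i, (0 <= t i <= 1)%R)
    (mu : 'I_N -> probability (Rpow R 1 d) R) (hmu : forall i, P2 (mu i)) :
  [/\ ereal_inf [set F_obj t mu pi | pi in @P2 R 2 d]
        = ereal_inf [set G_obj t gamma | gamma in feasible mu],
      exists gamma, is_minimizer (feasible mu) (G_obj t) gamma
    & forall gamma, is_minimizer (feasible mu) (G_obj t) gamma ->
        is_minimizer (@P2 R 2 d) (F_obj t mu) (distribution gamma (@first2 R N d))].
Proof.
have GleF pi : P2 pi ->
    ereal_inf [set G_obj t gamma | gamma in feasible mu] <= F_obj t mu pi.
  move=> pi2; have [Fy|] := eqVneq (F_obj t mu pi) +oo; first by rewrite Fy leey.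
  rewrite -ltey => Ffin; apply/lee_addgt0Pr => e e0.
  have [g fg] := G_obj_le_F_obj hN hmu pi2 e0 Ffin; apply: le_trans.
  by apply: ereal_inf_lbound; exists g.
split.
- apply/eqP; rewrite eq_le; apply/andP; split; apply: le_ereal_inf_tmp => _ [g fg <-].
    apply: le_trans (F_obj_le_G_obj t fg).
    by apply: ereal_inf_lbound; exists (distribution g (@first2 R N d)) => //; exact: P2_first2 fg.1.
  exact: GleF.
- exact: G_obj_has_minimizer.
- move=> g [fg gmin]; split=> [|pi pi2]; first exact: P2_first2 fg.1.
  apply: le_trans (F_obj_le_G_obj t fg) _; apply: le_trans (GleF pi pi2).
  by apply: le_ereal_inf_tmp => _ [g' fg' <-]; exact: gmin.
Qed.
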